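(* Consider an MPNN of depth $m$ as in the context, with message-passing matrix $\mathsf{A}=\mathsf{A}_{\mathrm{sym}}:=\mathbf{D}^{-1/2}\mathbf{A}\mathbf{D}^{-1/2}$ and constants satisfying $$\max\{\mathsf{w},\ \omega/\mathsf{w}+c_1\gamma+c_2\}\le 1,\qquad \gamma:=\sqrt{d_{\max}/d_{\min}}.$$ Let $v,u$ be nodes. If $\widetilde{\mathsf{OSQ}}_{v,u}(m,\mathsf{w})\cdot\mathsf{mix}_{y_{\mathsf{G}}}(v,u)\le 1$, i.e. the MPNN generates mixing $\mathsf{mix}_{y_{\mathsf{G}}}(v,u)$ among the features associated with nodes $v,u$, then the number of layers $m$ satisfies $$m\ge\frac{\tau(v,u)}{4c_2}+\frac{|\mathsf{E}|}{\sqrt{d_vd_u}}\left(\frac{\mathsf{mix}_{y_{\mathsf{G}}}(v,u)}{\gamma\mu}-\frac{1}{c_2}\left(\frac{\gamma+|1-c_2\lambda^*|^{r-1}}{\lambda_1}+2\frac{c^{(2)}}{\mu}\right)\right),$$ where $r=d_{\mathsf{G}}(v,u)$, $\mu=1+2c^{(2)}(1+\gamma)$ and $|1-c_2\lambda^*|=\max_{0<\ell\le n-1}|1-c_2\lambda_\ell|<1$.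
   Context: Graph: $\mathsf{G}=(\mathsf{V},\mathsf{E})$ is a fixed undirected, connected, non-bipartite graph with $n$ nodes, adjacency matrix $\mathbf{A}$, degrees $d_v$, diagonal degree matrix $\mathbf{D}$, maximal and minimal degrees $d_{\max},d_{\min}$; $d_{\mathsf{G}}$ is the shortest-path distance. $0=\lambda_0<\lambda_1\le\dots\le\lambda_{n-1}$ are the eigenvalues of the normalized Laplacian $\mathbf{I}-\mathbf{D}^{-1/2}\mathbf{A}\mathbf{D}^{-1/2}$. $\tau(v,u)$ is the commute time: the expected number of steps for a simple random walk on $\mathsf{G}$ started at $v$ to reach $u$ and return to $v$. MPNN: each node $v$ carries a feature $\mathbf{x}_v\in\mathbb{R}^d$; $\mathbf{X}\in\mathbb{R}^{n\times d}$ is the feature matrix. With message-passing matrix $\mathsf{A}\in\mathbb{R}^{n\times n}$, for $1\le t\le m$ the layer is $$\mathbf{h}_v^{(t)}=\sigma\Big(\boldsymbol{\Omega}^{(t)}\mathbf{h}_v^{(t-1)}+\mathbf{W}^{(t)}\sum_u\mathsf{A}_{vu}\,\psi^{(t)}(\mathbf{h}_v^{(t-1)},\mathbf{h}_u^{(t-1)})\Big),\qquad \mathbf{h}_v^{(0)}=\mathbf{x}_v,$$ with $\sigma:\mathbb{R}\to\mathbb{R}$ acting entrywise, $\boldsymbol{\Omega}^{(t)},\mathbf{W}^{(t)}\in\mathbb{R}^{d\times d}$, $\psi^{(t)}:\mathbb{R}^d\times\mathbb{R}^d\to\mathbb{R}^d$; the output is $y^{(m)}_{\mathsf{G}}(\mathbf{X})=\boldsymbol{\theta}^\top\mathsf{READ}(\{\mathbf{h}_v^{(m)}\})$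 with $\boldsymbol{\theta}$ a unit vector and $\mathsf{READ}$ entrywise $\mathsf{MAX}$, $\mathsf{MEAN}$ or $\mathsf{SUM}$ over nodes. Standing assumptions: $\sigma$ and $\psi^{(t)}$ are $\mathcal{C}^2$, $|\sigma'|,|\sigma''|\le 1$, and for all $t$: $\|\boldsymbol{\Omega}^{(t)}\|\le\omega$, $\|\mathbf{W}^{(t)}\|\le\mathsf{w}$, $\|\nabla_1\psi^{(t)}\|\le c_1$, $\|\nabla_2\psi^{(t)}\|\le c_2$, $\|\nabla^2\psi^{(t)}\|\le c^{(2)}$, where $\mathsf{w},c_2>0$, $\|\cdot\|$ is the operator norm, $\nabla_a\psi$ is the Jacobian in the $a$-th variable, and $\nabla^2\psi$ is the Hessian of $\psi$ arranged as a $2\times 2$ block matrix with blocks $\nabla^2_{ab}\psi\in\mathbb{R}^{d\times d^2}$, $(\nabla^2_{ab}\psi)_{r,d(\beta-1)+\gamma}=\partial_{a,\beta}\partial_{b,\gamma}\psi^r$. Over-squashing proxy: with $\mathbf{1}$ the all-ones vector, put $\mathbf{S}:=\frac{\omega}{\mathsf{w}}\mathbf{I}+c_1\,\mathrm{diag}(\mathsf{A}\mathbf{1})+c_2\,\mathsf{A}$, and for $0\le k\le m-1$, $\mathbf{P}_k:=(\mathbf{S}^{m-k-1})^\top\mathrm{diag}(\mathbf{1}^\top\mathbf{S}^k)(\mathsf{A}\mathbf{S}^{m-k-1})$ and $\mathbf{Q}_k:=\mathbf{P}_k+\mathbf{P}_k^\top+(\mathbf{S}^{m-k-1})^\top\mathrm{diag}(\mathbf{1}^\top\mathbf{S}^k(\mathrm{diag}(\mathsf{A}\mathbf{1})+\mathsf{A}))\mathbf{S}^{m-k-1}$.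 Then $$\widetilde{\mathsf{OSQ}}_{v,u}(m,\mathsf{w}):=\Big(\sum_{k=0}^{m-1}\mathsf{w}^{2m-k-1}\Big(\mathsf{w}(\mathbf{S}^{m-k})^\top\mathrm{diag}(\mathbf{1}^\top\mathbf{S}^k)\mathbf{S}^{m-k}+c^{(2)}\mathbf{Q}_k\Big)_{vu}\Big)^{-1}$$ (equal to $+\infty$ if the sum is $0$; the condition $\widetilde{\mathsf{OSQ}}_{v,u}(m,\mathsf{w})\cdot\mathsf{mix}_{y_{\mathsf{G}}}(v,u)\le1$ presupposes that it is finite). Mixing: for a twice differentiable $y:\mathbb{R}^{n\times d}\to\mathbb{R}$, $\mathsf{mix}_y(v,u)=\max_{\mathbf{X}}\max_{1\le\alpha,\beta\le d}|\partial^2y(\mathbf{X})/\partial x_v^\alpha\partial x_u^\beta|$. Here $y_{\mathsf{G}}:\mathbb{R}^{n\times d}\to\mathbb{R}$ is a twice differentiable target function. *)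

(* Defs.v *)
From HB Require Import structures.
From mathcomp Require Import all_boot all_order all_algebra.
From mathcomp Require Import all_classical all_reals all_analysis.

Set Implicit Arguments.
Unset Strict Implicit.
Unset Printing Implicit Defensive.

Import Order.TTheory GRing.Theory Num.Theory.
Import numFieldNormedType.Exports.

Local Open Scope classical_set_scope.
Local Open Scope ring_scope.

Section Graph.
Context {n : nat}.
Implicit Types (e : rel 'I_n) (v u : 'I_n).

Definition simple_graph e := symmetric e /\ irreflexive e.

Definition connected_graph e := forall v u, connect e v u.

Definition bipartite e :=
  exists color : 'I_n -> bool, forall v u, e v u -> color v != color u.

Definition deg e v : nat := #|[pred u | e v u]|.

Definition max_deg e : nat := \max_v deg e v.

(* n exceeds every degree, so it is neutral for the minimum *)
Definition min_deg e : nat := \big[minn/n]_v deg e v.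

(* each undirected edge is counted once, through its ordered pair i < j *)
Definition num_edges e : nat :=
  #|[pred p : 'I_n * 'I_n | (p.1 < p.2)%N && e p.1 p.2]|.

(* least k < n such that there is a walk of k steps from v to u (such a k
   exists as soon as v and u are connected; the value is n otherwise) *)
Definition graph_dist e v u : nat :=
  find (fun k => [exists s : k.-tuple 'I_n, path e v s && (last v s == u)])
       (iota 0 n).

End Graph.

Section GraphMatrices.
Context {R : realType} {n : nat}.
Implicit Types (e : rel 'I_n) (v u : 'I_n).

Definition adjacency e : 'M[R]_n := \matrix_(v, u) (e v u)%:R.

Definition inv_sqrt_deg e : 'M[R]_n :=
  diag_mx (\row_v (Num.sqrt (deg e v)%:R)^-1).

Definition sym_adjacency e : 'M[R]_n :=
  inv_sqrt_deg e *m adjacency e *m inv_sqrt_deg e.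

Definition normalized_laplacian e : 'M[R]_n := 1%:M - sym_adjacency e.

(* lam lists the eigenvalues of L with multiplicity, in nondecreasing order *)
Definition is_spectrum (L : 'M[R]_n) (lam : seq R) :=
  sorted <=%R lam /\ char_poly L = \prod_(l <- lam) ('X - l%:P).

Definition degree_ratio e : R := Num.sqrt ((max_deg e)%:R / (min_deg e)%:R).

Definition rw_step e v u : R := (e v u)%:R / (deg e v)%:R.

(* probability that the first t steps of the walk started at v are x *)
Definition rw_prob e v (t : nat) (x : t.-tuple 'I_n) : R :=
  \prod_(q <- pairmap (rw_step e) v x) q.

(* probability that the round trip from v to u and back is completed at time t
   exactly: mem2 s u v says that s visits u, and visits v at that time or
   later; belast v x is the trajectory up to time t - 1 (empty if t = 0) *)
Definition commute_at e v u (t : nat) : R :=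
  \sum_(x : t.-tuple 'I_n | mem2 (v :: x) u v && ~~ mem2 (belast v x) u v)
     rw_prob e v x.

(* expectation of the commute time, which is almost surely finite when the
   graph is connected *)
Definition commute_time e v u : \bar R :=
  (\sum_(0 <= t <oo) (t%:R * commute_at e v u t)%:E)%E.

End GraphMatrices.

Section Norms.
Context {R : realType}.

Definition l2norm {p : nat} (x : 'cV[R]_p) : R :=
  Num.sqrt (\sum_i x i 0 ^+ 2).

Definition opnorm {p q : nat} (M : 'M[R]_(p, q)) : R :=
  sup [set l2norm (M *m x) | x in [set x : 'cV[R]_q | l2norm x <= 1]].

End Norms.

(* All second directional derivatives exist and are continuous; on
   finite-dimensional spaces this is the class C^2. *)
Definition class_C2 {R : realType} {V W : normedModType R} (f : V -> W) :=
  [/\ forall a x, derivable f x a,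
      forall a b x, derivable ('D_b f) x a &
      forall a b, continuous ('D_a ('D_b f))].

Section Jacobians.
Context {R : realType} {d : nat}.
Implicit Types (f : 'cV[R]_d * 'cV[R]_d -> 'cV[R]_d) (p : 'cV[R]_d * 'cV[R]_d).

(* b-th basis vector of the first (a = false) or second (a = true) argument *)
Definition arg_dir (a : bool) (b : 'I_d) : 'cV[R]_d * 'cV[R]_d :=
  if a then (0, delta_mx b 0) else (delta_mx b 0, 0).

Definition arg_jacobian (a : bool) f p : 'M[R]_d :=
  \matrix_(r, b) ('D_(arg_dir a b) f p) r 0.

(* mxvec is row-major: the pair (b, g) is sent to column d * b + g (from 0) *)
Definition hessian_block (a1 a2 : bool) f p : 'M[R]_(d, d * d) :=
  \matrix_(r, k)
    mxvec (\matrix_(b, g)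
      ('D_(arg_dir a1 b) ('D_(arg_dir a2 g) f) p) r 0) 0 k.

Definition hessian f p : 'M[R]_(d + d, d * d + d * d) :=
  block_mx (hessian_block false false f p) (hessian_block false true f p)
           (hessian_block true false f p) (hessian_block true true f p).

End Jacobians.

Inductive readout := ReadMax | ReadMean | ReadSum.

(* The layers are numbered from 1; the values at index 0 are not used. *)
Record mpnn (R : realType) (n d : nat) := Mpnn {
  message_matrix : 'M[R]_n;
  sigma : R -> R;
  Omega : nat -> 'M[R]_d;
  Weight : nat -> 'M[R]_d;
  psi : nat -> 'cV[R]_d * 'cV[R]_d -> 'cV[R]_d;
  theta : 'cV[R]_d;
  read : readout }.

Section MPNN.
Context {R : realType} {n d : nat}.
Implicit Types (N : mpnn R n d) (X : 'M[R]_(n, d)).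

Fixpoint mpnn_features N X (t : nat) : 'I_n -> 'cV[R]_d :=
  if t is t'.+1 then
    let h := mpnn_features N X t' in
    fun v => map_mx (sigma N)
      (Omega N t *m h v
       + Weight N t *m \sum_u message_matrix N v u *: psi N t (h v, h u))
  else fun v => (row v X)^T.

Definition readout_apply (rd : readout) (h : 'I_n -> 'cV[R]_d) : 'cV[R]_d :=
  match rd with
  | ReadMax => \col_i sup (range (fun v => h v i 0))
  | ReadMean => n%:R^-1 *: \sum_v h v
  | ReadSum => \sum_v h v
  end.

Definition mpnn_output N (m : nat) X : R :=
  ((theta N)^T *m readout_apply (read N) (mpnn_features N X m)) 0 0.

Record mpnn_bounds N (m : nat) (omega w c1 c2 cH : R) : Prop := MpnnBounds {
  sigma_C2 : class_C2 (sigma N : R^o -> R^o);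
  sigma_d1 : forall x, `|derive1 (sigma N) x| <= 1;
  sigma_d2 : forall x, `|derive1n 2 (sigma N) x| <= 1;
  theta_unit : l2norm (theta N) = 1;
  w_gt0 : 0 < w;
  c2_gt0 : 0 < c2;
  Omega_le : forall t, (1 <= t <= m)%N -> opnorm (Omega N t) <= omega;
  Weight_le : forall t, (1 <= t <= m)%N -> opnorm (Weight N t) <= w;
  psi_C2 : forall t, (1 <= t <= m)%N -> class_C2 (psi N t);
  psi_d1 : forall t, (1 <= t <= m)%N ->
    forall p, opnorm (arg_jacobian false (psi N t) p) <= c1;
  psi_d2 : forall t, (1 <= t <= m)%N ->
    forall p, opnorm (arg_jacobian true (psi N t) p) <= c2;
  psi_hess : forall t, (1 <= t <= m)%N ->
    forall p, opnorm (hessian (psi N t) p) <= cH }.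

End MPNN.

Section OverSquashing.
Context {R : realType} {n : nat}.
Variables (A : 'M[R]_n) (m : nat) (omega w c1 c2 cH : R).

Definition row_sums : 'rV[R]_n := (A *m const_mx 1)^T.

Definition osq_S : 'M[R]_n :=
  (omega / w)%:M + c1 *: diag_mx row_sums + c2 *: A.

Definition osq_col_sums (k : nat) : 'rV[R]_n := const_mx 1 *m osq_S ^+ k.

Definition osq_P (k : nat) : 'M[R]_n :=
  (osq_S ^+ (m - k - 1))^T *m diag_mx (osq_col_sums k)
    *m (A *m osq_S ^+ (m - k - 1)).

Definition osq_Q (k : nat) : 'M[R]_n :=
  osq_P k + (osq_P k)^T
  + (osq_S ^+ (m - k - 1))^T
      *m diag_mx (osq_col_sums k *m (diag_mx row_sums + A))
      *m osq_S ^+ (m - k - 1).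

Definition osq_sum (v u : 'I_n) : R :=
  \sum_(0 <= k < m) w ^+ (2 * m - k - 1) *
    (w *: ((osq_S ^+ (m - k))^T *m diag_mx (osq_col_sums k)
             *m osq_S ^+ (m - k))
     + cH *: osq_Q k) v u.

(* in \bar R, the inverse of 0 is +oo *)
Definition osq (v u : 'I_n) : \bar R := ((osq_sum v u)%:E^-1)%E.

End OverSquashing.

Section Mixing.
Context {R : realType} {n d : nat}.
Implicit Types y : 'M[R]_(n, d) -> R.

Definition twice_differentiable y :=
  (forall X, differentiable y X) /\
  (forall (v : 'I_n) (b : 'I_d) X,
     differentiable ('D_(delta_mx v b) y : _ -> R) X).

(* the maximum over all feature matrices is a supremum in \bar R *)
Definition mix y (v u : 'I_n) : \bar R :=
  ereal_sup [set z | exists X (a b : 'I_d),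
    z = (`|'D_(delta_mx v a) ('D_(delta_mx u b) y) X|)%:E].

End Mixing.

(* Main.v *)
Require Import Defs.
From HB Require Import structures.
From mathcomp Require Import all_boot all_order all_algebra.
From mathcomp Require Import all_classical all_reals all_analysis.
From mathcomp Require Import ring lra zify.

Set Implicit Arguments.
Unset Strict Implicit.
Unset Printing Implicit Defensive.

Import Order.TTheory GRing.Theory Num.Theory.
Import numFieldNormedType.Exports.

Local Open Scope classical_set_scope.
Local Open Scope ring_scope.

(* By the choice of the constants, S is bounded entrywise by the lazy walk T =
   (1 - c2) I + c2 A = I - c2 L, where A is the normalized adjacency matrix
   and L the normalized Laplacian, and the column sums of S^k are at most
   gamma. Since c2 A = T - (1 - c2) I, the sum defining the over-squashing
   proxy is thus controlled by the entry (v, u) of T^0 + ... + T^(2m), up to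
   the boundary term 2 cH / c2. In an orthonormal eigenbasis of L this is a
   geometric sum: the kernel of L contributes about 2 m sqrt(d_v d_u) / (2
   |E|), the other eigenvectors contribute 1 / c2 times the Green function
   of L, up to an error of order beta^(2m + 1) / (c2 lambda_1), and the
   Green function is expressible through the commute time. For v <> u the
   extra power in the sum costs one copy of the kernel entry f; it is
   absorbed because the Green function is at most (gamma - f) / lambda_1
   minus the commute time term, together with lambda_1 <= 1 if v and u are
   not adjacent, and with r = 1 if they are. *)

(** * Diagonalization of real symmetric matrices *)

Section SpectralTheorem.
Context {R : rcfType}.

Lemma row_normE n (x : 'rV[R]_n) : (x *m x^T) 0 0 = \sum_i x 0 i ^+ 2.
Proof. by rewrite mxE; apply: eq_bigr => i _; rewrite mxE expr2. Qed.

Lemma row_norm_ge0 n (x : 'rV[R]_n) : 0 <= (x *m x^T) 0 0.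
Proof. by rewrite row_normE sumr_ge0// => i _; rewrite sqr_ge0. Qed.

Lemma row_norm_eq0 n (x : 'rV[R]_n) : ((x *m x^T) 0 0 == 0) = (x == 0).
Proof.
apply/idP/eqP => [|->]; last by rewrite mul0mx mxE.
rewrite row_normE psumr_eq0 => [/allP x0|i _]; last exact: sqr_ge0.
apply/rowP => i; rewrite mxE; apply/eqP; rewrite -sqrf_eq0.
exact: x0 (mem_index_enum i).
Qed.

(** The reflection in the hyperplane orthogonal to [q - e0] exchanges the unit vectors [e0] and [q];
    if they coincide, the identity serves. *)
Lemma householder n (q : 'rV[R]_n.+1) : (q *m q^T) 0 0 = 1 ->
  exists H : 'M[R]_n.+1, [/\ H^T = H, H *m H = 1%:M & delta_mx 0 0 *m H = q].
Proof.
move=> q1; set e0 : 'rV[R]_n.+1 := delta_mx 0 0.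
have [->|qNe] := eqVneq q e0.
  by exists 1%:M; rewrite tr_scalar_mx !mulmx1.
have [w wE] : {w | w = q - e0} by exists (q - e0).
pose a := (w *m w^T) 0 0.
have a_neq0 : a != 0 by rewrite row_norm_eq0 wE subr_eq0.
have wwT : w *m w^T = a%:M by apply: mx11_scalar.
have e0w : e0 *m w^T = (q 0 0 - 1)%:M.
  rewrite wE [LHS]mx11_scalar; congr _%:M; rewrite mxE (bigD1 0)//= big1.
    by rewrite !mxE !eqxx mul1r addr0.
  by move=> i i0; rewrite !mxE (negbTE i0) andbF mul0r.
have aE : a = 2 - 2 * q 0 0.
  rewrite /a wE linearB/= mulmxBl mulmxBr -/e0.
  rewrite [q *m q^T]mx11_scalar q1.
  have -> : e0 *m (q^T - e0^T) = (q 0 0 - 1)%:M by rewrite -linearB/= -wE.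
  have -> : q *m e0^T = (q 0 0)%:M.
    rewrite [LHS]mx11_scalar; congr _%:M; rewrite mxE (bigD1 0)//= big1.
      by rewrite !mxE !eqxx mulr1 addr0.
    by move=> i i0; rewrite !mxE (negbTE i0) andbF mulr0.
  by rewrite !mxE !eqxx !mulr1n; ring.
exists (1%:M - (2 / a) *: (w^T *m w)); split.
- by rewrite linearB/= linearZ/= trmx_mul trmxK tr_scalar_mx.
- rewrite mulmxBl mul1mx mulmxBr mulmx1 -!scalemxAl -!scalemxAr.
  rewrite mulmxA -(mulmxA w^T w w^T) wwT mul_mx_scalar -scalemxAl !scalerA.
  rewrite (_ : 2 / a * (2 / a * a) = 2 / a + 2 / a).
    by rewrite scalerDl opprB addrK subrK.
  by field.
rewrite mulmxBr mulmx1 -scalemxAr mulmxA e0w mul_scalar_mx scalerA.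
rewrite (_ : 2 / a * _ = -1) ?scaleN1r ?opprK.
  by rewrite wE addrC subrK.
by rewrite (_ : q 0 0 - 1 = - a / 2); [field | rewrite aE; field].
Qed.

(** Deflation: a reflection moves a unit eigenvector for the head of [lam] to the first basis
    vector, symmetry splits off the remaining block, and the induction applies to the tail. Hence
    row [i] of [P] is an eigenvector for the [i]-th entry of [lam], in the given order. *)
Lemma symmetric_diagonalization n (L : 'M[R]_n) (lam : seq R) : L^T = L ->
    char_poly L = \prod_(l <- lam) ('X - l%:P) ->
  exists P : 'M[R]_n, P *m P^T = 1%:M /\
    L = P^T *m diag_mx (\row_i lam`_i) *m P.
Proof.
elim: n L lam => [|n IHn] L lam Lsym Lchar.
  by exists 1%:M; split; apply/matrixP => -[].
case: lam Lchar => [|l lam] Lchar.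
  (* An empty [lam] would make the characteristic polynomial constant. *)
  have := size_char_poly L; rewrite Lchar big_nil size_poly1 => -[] //.
have : eigenvalue L l.
  by rewrite eigenvalue_root_char Lchar big_cons rootM root_XsubC eqxx.
case/eigenvalueP => x xL x0.
have nx_gt0 : 0 < (x *m x^T) 0 0 by rewrite lt0r row_norm_eq0 x0 row_norm_ge0.
pose q := (Num.sqrt ((x *m x^T) 0 0))^-1 *: x.
have q1 : (q *m q^T) 0 0 = 1.
  rewrite linearZ/= -scalemxAl -scalemxAr scalerA mxE.
  rewrite -invfM -expr2 sqr_sqrtr ?row_norm_ge0// mulVf//.
  by rewrite gt_eqF.
have qL : q *m L = l *: q by rewrite -scalemxAl xL scalerA mulrC -scalerA.
have [H [Hsym HH eH]] := householder q1.
have [B BH] : {B | B = H *m L *m H} by exists (H *m L *m H).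
have Bsym : B^T = B by rewrite BH !trmx_mul Hsym Lsym mulmxA.
have rowB : delta_mx 0 0 *m B = l *: (delta_mx 0 0 : 'rV_n.+1).
  by rewrite BH !mulmxA eH qL -scalemxAl -eH -mulmxA HH mulmx1.
have B0 j : B 0 j = l * (j == 0)%:R.
  by move/rowP: rowB => /(_ j); rewrite -rowE !mxE eqxx andTb.
pose B' := drsubmx (B : 'M[R]_(1 + n)).
have BE : (B : 'M[R]_(1 + n)) = block_mx l%:M 0 0 B'.
  rewrite -[LHS](@submxK _ 1 n 1 n); congr block_mx.
  - apply/matrixP => i j; rewrite !mxE !ord1.
    rewrite (_ : lshift n 0 = 0) ?B0; last exact: val_inj.
    by rewrite eqxx mulr1 mulr1n.
  - apply/matrixP => i j; rewrite !mxE (_ : lshift n i = 0) ?B0.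
      by rewrite mulr0.
    by apply: val_inj; rewrite /= ord1.
  - apply/matrixP => i j; rewrite -Bsym !mxE (_ : lshift n j = 0) ?B0.
      by rewrite mulr0.
    by apply: val_inj; rewrite /= ord1.
have charB : char_poly B = char_poly L.
  have HHp : map_mx polyC H *m map_mx polyC H = 1%:M.
    by rewrite -map_mxM HH map_scalar_mx.
  rewrite /char_poly /char_poly_mx BH !map_mxM.
  rewrite (_ : _ - _ = map_mx polyC H *m ('X%:M - map_mx polyC L)
                         *m map_mx polyC H); last first.
    rewrite mulmxBr mulmxBl; congr (_ - _).
    by rewrite mul_mx_scalar -scalemxAl HHp scalemx1.
  by rewrite !det_mulmx mulrAC -det_mulmx HHp det1 mul1r.
have charB' : char_poly B' = \prod_(l <- lam) ('X - l%:P).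
  have Xl0 : 'X - l%:P != 0 by rewrite polyXsubC_eq0.
  (* The corner of the block form contributes the factor ['X - l%:P], which cancels against the head
     of the product. *)
  apply: (mulfI Xl0).
  have := charB; rewrite Lchar big_cons => <-.
  have -> : char_poly B = @char_poly R (1 + n) (block_mx l%:M 0 0 B').
    by rewrite -BE.
  rewrite /char_poly char_block_diag_mx det_ublock.
  congr (_ * _).
  by rewrite /char_poly_mx map_scalar_mx -raddfB/= det_scalar1.
have B'sym : B'^T = B' by rewrite /B' (@trmx_drsub _ 1 n 1 n) Bsym.
have [P' [PP' B'E]] := IHn B' lam B'sym charB'.
pose P1 : 'M[R]_n.+1 := block_mx 1%:M 0 0 P' : 'M[R]_(1 + n).
exists (P1 *m H); split.
  rewrite trmx_mul Hsym mulmxA -[P1 *m H *m H]mulmxA HH mulmx1.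
  rewrite /P1 (@tr_block_mx _ 1 n 1 n) (@mulmx_block _ 1 n 1 n 1 n).
  rewrite !trmx0 tr_scalar_mx.
  rewrite !(mulmx0, mul0mx, addr0, add0r, mulmx1) PP'.
  by rewrite -(@scalar_mx_block _ 1 n).
have -> : L = H *m B *m H.
  by rewrite BH !mulmxA HH mul1mx -mulmxA HH mulmx1.
rewrite trmx_mul Hsym !mulmxA; congr (_ *m _); rewrite -!mulmxA; congr (_ *m _).
rewrite !mulmxA.
have -> : diag_mx (\row_(i < n.+1) (l :: lam)`_i) =
    block_mx l%:M 0 0 (diag_mx (\row_i lam`_i)) :> 'M[R]_(1 + n).
  rewrite (_ : \row__ _ = row_mx l%:M (\row_i lam`_i)).
    rewrite (@diag_mx_row _ n 1); congr block_mx.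
    by apply/matrixP => i j; rewrite !mxE !ord1 !eqxx.
  apply/rowP => i; case: (@splitP 1 n i) => j ij.
    rewrite (_ : i = lshift n j) ?row_mxEl; last exact: val_inj.
    by rewrite !mxE !ord1 !eqxx.
  rewrite (_ : i = rshift 1 j) ?row_mxEr; last exact: val_inj.
  by rewrite !mxE.
rewrite /P1 (@tr_block_mx _ 1 n 1 n) !(@mulmx_block _ 1 n 1 n 1 n).
rewrite !trmx0 tr_scalar_mx.
by rewrite !(mulmx0, mul0mx, addr0, add0r, mulmx1, mul1mx) -B'E -BE.
Qed.

End SpectralTheorem.

(** * Degrees and the normalized adjacency matrix *)

Section Degrees.
Context {R : realType} {n : nat} (e : rel 'I_n).
Hypotheses (e_simple : simple_graph e) (e_conn : connected_graph e)
  (e_nonbip : ~ bipartite e).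

Let e_sym : symmetric e := e_simple.1.

Definition sqrt_deg (v : 'I_n) : R := Num.sqrt (deg e v)%:R.
Local Notation sd := sqrt_deg.

(** An isolated node would, by connectedness, be the only node, and a graph without edges is
    bipartite. *)
Lemma deg_gt0 v : (0 < deg e v)%N.
Proof.
rewrite lt0n; apply/negP => /eqP/card0_eq d0; apply: e_nonbip.
exists (fun=> true) => a b eab.
have va : v = a.
  have /connectP[[|c p]/= pth ->//] := e_conn v a.
  by have := d0 c; rewrite inE; case/andP: pth => ->.
by have := d0 b; rewrite inE va eab.
Qed.

Lemma sqrt_deg_gt0 v : 0 < sd v.
Proof. by rewrite sqrtr_gt0 ltr0n deg_gt0. Qed.

Lemma sqrt_deg_neq0 v : sd v != 0.
Proof. by rewrite gt_eqF// sqrt_deg_gt0. Qed.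

Lemma sqr_sqrt_deg v : sd v ^+ 2 = (deg e v)%:R.
Proof. by rewrite sqr_sqrtr. Qed.

Lemma sum_edges v : \sum_u (e v u)%:R = (deg e v)%:R :> R.
Proof.
rewrite -natr_sum /deg -sum1_card [in RHS]big_mkcond/=; congr _%:R.
Qed.

(** Handshake count: exchanging coordinates matches the adjacent pairs with [p.1 < p.2] with the
    other ones, irreflexivity excluding equality. *)
Lemma sum_deg : (\sum_v deg e v = 2 * num_edges e)%N.
Proof.
have -> : (\sum_v deg e v = #|[pred p : 'I_n * 'I_n | e p.1 p.2]|)%N.
  rewrite -sum1_card (eq_bigr (fun v => \sum_(u | e v u) 1)%N) => [|v _].
    by rewrite pair_big_dep/=.
  by rewrite /deg -sum1_card.
rewrite -(cardID [pred p : 'I_n * 'I_n | (p.1 < p.2)%N]) mul2n -addnn.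
rewrite /num_edges; congr (_ + _)%N.
  by apply: eq_card => -[a b]; rewrite !inE andbC.
have inj : injective (fun p : 'I_n * 'I_n => (p.2, p.1)).
  by move=> [a b] [c d] [-> ->].
rewrite -[RHS](fintype.card_image inj); apply: eq_card => -[a b].
rewrite !inE/= -leqNgt; apply/andP/fintype.imageP => [[ab eab]|[[c d]]]/=.
  exists (b, a); rewrite ?inE//= e_sym eab andbT ltn_neqAle ab andbT.
  by apply: contraTneq eab => /val_inj ->; rewrite e_simple.2.
rewrite inE/= => /andP[cd ecd] [-> ->]; rewrite (ltnW cd).
by rewrite e_sym.
Qed.

Lemma num_edges_gt0 (v : 'I_n) : (0 < num_edges e)%N.
Proof.
rewrite -(ltn_pmul2l (isT : (0 < 2)%N)) -sum_deg muln0.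
by rewrite (bigD1 v)//= addn_gt0 deg_gt0.
Qed.

Lemma sum_sqr_sqrt_deg : \sum_v sd v ^+ 2 = 2 * (num_edges e)%:R.
Proof.
rewrite -natrM -sum_deg natr_sum; apply: eq_bigr => v _.
exact: sqr_sqrt_deg.
Qed.

Lemma sym_adjacencyE v u :
  sym_adjacency e v u = (e v u)%:R / (sd v * sd u) :> R.
Proof.
rewrite mxE (bigD1 u)//= big1 ?addr0 => [|k ku]; last first.
  by rewrite [X in _ * X]mxE (negbTE ku) mulr0.
rewrite mxE (bigD1 v)//= big1 ?addr0 => [|k kv]; last first.
  by rewrite [X in X * _]mxE eq_sym (negbTE kv) mul0r.
by rewrite !mxE !eqxx !mulr1n invfM mulrA [_^-1 * _]mulrC.
Qed.

Lemma sym_adjacency_ge0 v u : 0 <= sym_adjacency e v u :> R.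
Proof. by rewrite sym_adjacencyE divr_ge0// mulr_ge0// sqrtr_ge0. Qed.

Lemma tr_sym_adjacency : (sym_adjacency e)^T = sym_adjacency e :> 'M[R]_n.
Proof.
apply/matrixP => v u; rewrite mxE !sym_adjacencyE e_sym.
by rewrite [sd u * _]mulrC.
Qed.

Lemma sqrt_deg_sym_adjacency v :
  \sum_u sym_adjacency e v u * sd u = sd v :> R.
Proof.
rewrite (eq_bigr (fun u => (e v u)%:R * (sd v)^-1)) => [|u _].
  rewrite -mulr_suml sum_edges -sqr_sqrt_deg expr2 mulfK//.
  exact: sqrt_deg_neq0.
rewrite sym_adjacencyE; field.
by rewrite !sqrt_deg_neq0.
Qed.

(** Up to the factor 2, this is the quadratic form of [I - A] for [eps = 1] and of [I + A] for
    [eps = -1]. The first sign controls the Laplacian spectrum at 0, the second at 2. *)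
Lemma sum_edge_squares (eps : R) (x : 'I_n -> R) : eps ^+ 2 = 1 ->
  \sum_v \sum_u (e v u)%:R * (x v / sd v - eps * (x u / sd u)) ^+ 2 =
  2 * (\sum_v x v ^+ 2
       - eps * \sum_v x v * \sum_u sym_adjacency e v u * x u).
Proof.
move=> eps2.
have sq v : \sum_u (e v u)%:R * (x v / sd v) ^+ 2 = x v ^+ 2.
  rewrite -mulr_suml sum_edges -sqr_sqrt_deg; field.
  exact: sqrt_deg_neq0.
have -> : \sum_v \sum_u (e v u)%:R * (x v / sd v - eps * (x u / sd u)) ^+ 2 =
    \sum_v \sum_u ((e v u)%:R * (x v / sd v) ^+ 2
      + (e v u)%:R * (x u / sd u) ^+ 2
      - 2 * eps * (x v * (sym_adjacency e v u * x u))).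
  apply: eq_bigr => v _; apply: eq_bigr => u _; rewrite sym_adjacencyE.
  rewrite sqrrB [(eps * _) ^+ 2]exprMn eps2 mul1r; field.
  by rewrite !sqrt_deg_neq0.
under eq_bigr do rewrite sumrB big_split /= sq -mulr_sumr -mulr_sumr.
rewrite sumrB big_split/= -mulr_sumr [X in _ + X - _]exchange_big/=.
have -> : \sum_u \sum_v (e v u)%:R * (x u / sd u) ^+ 2 = \sum_u x u ^+ 2.
  by apply: eq_bigr => u _; under eq_bigr do rewrite e_sym; exact: sq.
by ring.
Qed.

Lemma edge_squares_ge0 (eps : R) (x : 'I_n -> R) :
  0 <= \sum_v \sum_u (e v u)%:R * (x v / sd v - eps * (x u / sd u)) ^+ 2.
Proof.
by apply: sumr_ge0 => v _; apply: sumr_ge0 => u _; rewrite mulr_ge0// sqr_ge0.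
Qed.

Lemma edge_squares_eq0 (eps : R) (x : 'I_n -> R) :
    \sum_v \sum_u (e v u)%:R * (x v / sd v - eps * (x u / sd u)) ^+ 2 = 0 ->
  forall v u, e v u -> x v / sd v = eps * (x u / sd u).
Proof.
move=> /eqP; rewrite psumr_eq0 => [/allP s0 v u evu|v _]; last first.
  by apply: sumr_ge0 => u _; rewrite mulr_ge0// sqr_ge0.
have := s0 v (mem_index_enum v); rewrite /=.
rewrite psumr_eq0 => [/allP|b _]; last first.
  by rewrite mulr_ge0// sqr_ge0.
move=> /(_ u (mem_index_enum u))/=.
by rewrite evu mul1r sqrf_eq0 subr_eq0 => /eqP.
Qed.

Lemma connected_const (T : Type) (g : 'I_n -> T) :
  (forall v u, e v u -> g v = g u) -> forall v u, g v = g u.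
Proof.
move=> ge v u; have /connectP[p + ->] := e_conn v u.
by elim: p v => //= a p IHp v /andP[/ge-> /IHp].
Qed.

(** By connectedness [g] has constant absolute value; were it nonzero, the sign of [g] would be a
    proper 2-colouring. *)
Lemma alternating_eq0 (g : 'I_n -> R) :
  (forall v u, e v u -> g v = - g u) -> forall v, g v = 0.
Proof.
move=> ge v; apply: contrapT => /eqP gv0; apply: e_nonbip.
have norm_g a : `|g a| = `|g v|.
  apply: (@connected_const _ (fun a => `|g a|)) => b c /ge ->.
  by rewrite normrN.
have g0 a : g a != 0 by rewrite -normr_eq0 norm_g normr_eq0.
exists (fun a => 0 < g a) => a b /ge ->; rewrite oppr_gt0.
by have := g0 b; case: ltgtP.
Qed.

Lemma min_deg_le v : (min_deg e <= deg e v)%N.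
Proof.
rewrite /min_deg; elim: (index_enum _) (mem_index_enum v) => // a s IHs.
by rewrite inE big_cons geq_min => /predU1P[->|/IHs->]; rewrite ?leqnn ?orbT.
Qed.

Lemma max_deg_ge v : (deg e v <= max_deg e)%N.
Proof. exact: leq_bigmax. Qed.

Lemma min_deg_gt0 (v : 'I_n) : (0 < min_deg e)%N.
Proof.
rewrite /min_deg; elim/big_ind: _ => [|a b a0 b0|u _]; last exact: deg_gt0.
  (* The neutral value [n] of the minimum is positive because the node [v] exists. *)
  by case: (n) v => // -[].
by rewrite leq_min a0.
Qed.

Lemma sqrt_deg_ratio_le v u : sd v / sd u <= degree_ratio e.
Proof.
rewrite /degree_ratio /sqrt_deg -sqrtrV ?ler0n// -sqrtrM ?ler0n//.
rewrite ler_wsqrtr// ler_pM ?invr_ge0 ?ler0n//.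
  by rewrite ler_nat max_deg_ge.
rewrite lef_pV2 ?posrE ?ltr0n ?deg_gt0// ?(min_deg_gt0 v)//.
by rewrite ler_nat min_deg_le.
Qed.

Lemma sqrt_deg_ratio_min_le v :
  sd v / Num.sqrt (min_deg e)%:R <= degree_ratio e.
Proof.
rewrite /degree_ratio /sqrt_deg -sqrtrV ?ler0n// -sqrtrM ?ler0n//.
by rewrite ler_wsqrtr// ler_wpM2r ?invr_ge0 ?ler0n// ler_nat max_deg_ge.
Qed.

Lemma sqrt_min_deg_gt0 (v : 'I_n) : 0 < Num.sqrt (min_deg e)%:R :> R.
Proof. by rewrite sqrtr_gt0 ltr0n (min_deg_gt0 v). Qed.

Lemma sqrt_min_deg_le v : Num.sqrt (min_deg e)%:R <= sd v.
Proof. by rewrite ler_wsqrtr// ler_nat min_deg_le. Qed.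

Lemma degree_ratio_ge1 (v : 'I_n) : 1 <= degree_ratio e :> R.
Proof.
by rewrite -(divff (sqrt_deg_neq0 v)) sqrt_deg_ratio_le.
Qed.

End Degrees.

(** * Spectrum of the normalized Laplacian *)

Section LaplacianSpectrum.
Context {R : realType} {n : nat} (e : rel 'I_n.+1).
Hypotheses (e_simple : simple_graph e) (e_conn : connected_graph e)
  (e_nonbip : ~ bipartite e).
Context (lam : seq R) (P : 'M[R]_n.+1).
Hypotheses (lam_spec : is_spectrum (normalized_laplacian e) lam)
  (PPT : P *m P^T = 1%:M)
  (LP : normalized_laplacian e = P^T *m diag_mx (\row_i lam`_i) *m P).

Local Notation sd := (@sqrt_deg R _ e).
Local Notation A := (sym_adjacency e : 'M[R]_n.+1).
Local Notation E := (num_edges e)%:R.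

Lemma tr_normalized_laplacian :
  (normalized_laplacian e)^T = normalized_laplacian e :> 'M[R]_n.+1.
Proof. by rewrite linearB/= tr_scalar_mx tr_sym_adjacency. Qed.

Lemma size_spectrum : size lam = n.+1.
Proof.
have := size_char_poly (normalized_laplacian e : 'M[R]_n.+1).
by rewrite lam_spec.2 size_prod_XsubC => -[].
Qed.

Lemma spectrum_nondecreasing i j : (i <= j < n.+1)%N -> lam`_i <= lam`_j.
Proof.
move=> /andP[ij jn]; apply: (sorted_leq_nth le_trans le_refl) => //.
- exact: lam_spec.1.
- by rewrite inE size_spectrum (leq_ltn_trans ij).
- by rewrite inE size_spectrum.
Qed.

Lemma eigenvector_orthonormal l k :
  \sum_v P l v * P k v = (l == k)%:R.
Proof.
move/matrixP: PPT => /(_ l k); rewrite !mxE => <-.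
by apply: eq_bigr => v _; rewrite mxE.
Qed.

Lemma eigenvector_complete v u : \sum_l P l v * P l u = (v == u)%:R.
Proof.
have /matrixP/(_ v u) := mulmx1C PPT; rewrite !mxE => <-.
by apply: eq_bigr => l _; rewrite mxE.
Qed.

Lemma eigenvectorE l v : \sum_u A v u * P l u = (1 - lam`_l) * P l v.
Proof.
have AE : A = 1%:M - normalized_laplacian e by rewrite opprB addrC subrK.
have : P *m A = \matrix_(i, j) ((1 - lam`_i) * P i j).
  rewrite AE mulmxBr mulmx1 LP !mulmxA PPT mul1mx mul_diag_mx.
  by apply/matrixP => i j; rewrite !mxE mulrBl mul1r.
move/matrixP/(_ l v); rewrite !mxE => <-; apply: eq_bigr => u _.
by rewrite mulrC -[in RHS](tr_sym_adjacency e_simple) [in RHS]mxE.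
Qed.

Lemma eigenvector_edge_squares (eps : R) l : eps ^+ 2 = 1 ->
  \sum_v \sum_u (e v u)%:R * (P l v / sd v - eps * (P l u / sd u)) ^+ 2 =
  2 * (1 - eps * (1 - lam`_l)).
Proof.
move=> eps2; rewrite sum_edge_squares//; congr (_ * (_ - eps * _)).
  by under eq_bigr do rewrite expr2; rewrite eigenvector_orthonormal eqxx.
under eq_bigr do rewrite eigenvectorE mulrCA.
by rewrite -mulr_sumr eigenvector_orthonormal eqxx mulr1.
Qed.

Lemma spectrum_ge0 (l : 'I_n.+1) : 0 <= lam`_l.
Proof.
have := edge_squares_ge0 e 1 (P l).
by rewrite eigenvector_edge_squares ?expr1n//; lra.
Qed.

(** At the value 2 the form with [eps = -1] vanishes, so the eigenvector divided by [sd] alternates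
    along edges and is 0 as the graph is not bipartite. Strictness is what later yields
    [beta < 1]. *)
Lemma spectrum_lt2 (l : 'I_n.+1) : lam`_l < 2.
Proof.
have sq : (-1 : R) ^+ 2 = 1 by rewrite sqrrN expr1n.
have := edge_squares_ge0 e (-1) (P l).
rewrite eigenvector_edge_squares// => le2.
rewrite lt_neqAle; apply/andP; split; last by lra.
apply/eqP => lam2; have := eigenvector_edge_squares l sq.
rewrite lam2 (_ : 2 * _ = 0); last by ring.
move/(@edge_squares_eq0 _ _ e) => alt.
have P0 v : P l v = 0.
  have alt0 a b : e a b -> P l a / sd a = - (P l b / sd b).
    by move=> /alt ->; rewrite mulN1r.
  have /eqP := alternating_eq0 e_conn e_nonbip alt0 v.
  rewrite mulf_eq0 invr_eq0 (negbTE (sqrt_deg_neq0 e_conn e_nonbip v)) orbF.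
  by move/eqP.
have := eigenvector_orthonormal l l; rewrite eqxx big1 => [/eqP|v _].
  by rewrite eq_sym oner_eq0.
by rewrite P0 mul0r.
Qed.

(** The form with [eps = 1] vanishes, so the eigenvector divided by [sd] is constant on the
    connected graph; unit norm fixes [b] up to sign. *)
Lemma harmonic_eigenvector (l : 'I_n.+1) : lam`_l = 0 ->
  exists b, [/\ b ^+ 2 * (2 * E) = 1 & forall v, P l v = b * sd v].
Proof.
move=> l0; have := @eigenvector_edge_squares 1 l (expr1n _ _).
rewrite l0 subr0 mul1r subrr mulr0.
move/(@edge_squares_eq0 _ _ e) => flat.
have flat1 a b : e a b -> P l a / sd a = P l b / sd b.
  by move=> /flat ->; rewrite mul1r.
have Pl v : P l v = P l ord0 / sd ord0 * sd v.
  rewrite -(connected_const e_conn flat1 v ord0) divfK//.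
  exact: sqrt_deg_neq0.
exists (P l ord0 / sd ord0); split=> //.
rewrite -(sum_sqr_sqrt_deg e_simple) mulr_sumr.
transitivity (\sum_v P l v * P l v).
  by apply: eq_bigr => v _; rewrite [in RHS]Pl; ring.
by rewrite eigenvector_orthonormal eqxx.
Qed.

(** [sd] is fixed by [A], so without a zero eigenvalue it would be orthogonal to all eigenvectors
    and vanish by completeness. As the spectrum is sorted and nonnegative, the zero eigenvalue comes
    first. *)
Lemma spectrum0 : lam`_0 = 0.
Proof.
have [l l0] : exists l : 'I_n.+1, lam`_l = 0.
  apply: contrapT => /forallNP lam_neq0.
  have c0 l : \sum_v P l v * sd v = 0.
    have : (1 - lam`_l) * \sum_v P l v * sd v = \sum_v P l v * sd v.
      rewrite mulr_sumr; under eq_bigr do rewrite mulrA -eigenvectorE mulr_suml.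
      rewrite exchange_big/=; apply: eq_bigr => u _.
      rewrite -[in RHS](sqrt_deg_sym_adjacency e_conn e_nonbip) mulr_sumr.
      apply: eq_bigr => v _.
      by rewrite -[in RHS](tr_sym_adjacency e_simple) [in RHS]mxE; ring.
    move/eqP; rewrite mulrBl mul1r -subr_eq0 addrAC subrr add0r oppr_eq0.
    by rewrite mulf_eq0 => /orP[/eqP/lam_neq0|/eqP].
  have : \sum_v sd v * (ord0 == v)%:R = 0.
    under eq_bigr do rewrite -eigenvector_complete mulr_sumr.
    rewrite exchange_big/= big1// => l _.
    under eq_bigr do rewrite mulrCA [sd _ * _]mulrC.
    by rewrite -mulr_sumr c0 mulr0.
  rewrite (bigD1 ord0)//= big1 => [|v v0].
    by rewrite mulr1 addr0 => /eqP; rewrite (negbTE (sqrt_deg_neq0 _ _ _)).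
  by rewrite eq_sym (negbTE v0) mulr0.
apply/eqP; rewrite eq_le (spectrum_ge0 ord0) andbT.
by rewrite -[X in _ <= X]l0 spectrum_nondecreasing//=.
Qed.

Lemma harmonic_projectionE v u : P ord0 v * P ord0 u = sd v * sd u / (2 * E).
Proof.
have [b [b2 Pb]] := @harmonic_eigenvector ord0 spectrum0.
have E0 : E != 0 :> R by rewrite pnatr_eq0 -lt0n (num_edges_gt0 _ _ _ ord0).
rewrite !Pb; have E2 : 2 * E != 0 :> R by rewrite mulf_eq0 negb_or E0 pnatr_eq0.
apply: (mulIf E2).
by rewrite divfK// -[RHS]mul1r -[X in _ = X * _]b2; ring.
Qed.

(** Two kernel rows would both be unit multiples of [sd], with inner product 1 or -1 instead of
    0. *)
Lemma spectrum_gt0 (l : 'I_n.+1) : l != ord0 -> 0 < lam`_l.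
Proof.
move=> l0; rewrite lt_neqAle spectrum_ge0 andbT eq_sym; apply/eqP => lam0.
have [b [b2 Pb]] := harmonic_eigenvector lam0.
have [a [a2 Pa]] := @harmonic_eigenvector ord0 spectrum0.
have := eigenvector_orthonormal l ord0; rewrite (negbTE l0).
rewrite (_ : \sum__ _ = a * b * (2 * E)).
  move=> ab0; have : (a * b * (2 * E)) ^+ 2 = 1.
    transitivity (a ^+ 2 * (2 * E) * (b ^+ 2 * (2 * E))); first by ring.
    by rewrite a2 b2 mulr1.
  by rewrite ab0 expr0n/= => /eqP; rewrite eq_sym oner_eq0.
rewrite -(sum_sqr_sqrt_deg e_simple) mulr_sumr; apply: eq_bigr => v _.
by rewrite Pa Pb; ring.
Qed.

End LaplacianSpectrum.

(** * Commute time *)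

Section CommuteTime.
Context {R : realType} {n : nat} (e : rel 'I_n) (v u : 'I_n).
Hypotheses (e_conn : connected_graph e) (e_nonbip : ~ bipartite e).

Local Notation step := (@rw_step R n e).

Lemma rw_step_ge0 a b : 0 <= step a b.
Proof. by rewrite divr_ge0. Qed.

Lemma sum_rw_step a : \sum_b step a b = 1.
Proof.
rewrite -mulr_suml sum_edges divff// pnatr_eq0 -lt0n.
exact: deg_gt0.
Qed.

Lemma sum_tuple_cons (T : finType) t (P : pred (seq T)) (F : seq T -> R) :
  \sum_(x : t.+1.-tuple T | P x) F x =
  \sum_b \sum_(x : t.-tuple T | P (b :: x)) F (b :: x).
Proof.
rewrite pair_big_dep/=.
rewrite (reindex (fun p : T * t.-tuple T => [tuple of p.1 :: p.2]))//=.
exists (fun x => (thead x, [tuple of behead x])) => [[b x] _|x _] /=.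
  by congr (_, _); apply: val_inj.
by rewrite [RHS]tuple_eta.
Qed.

(* For a = v this is commute_at. *)
Definition round_trip_at (a : 'I_n) t : R :=
  \sum_(x : t.-tuple 'I_n | mem2 (a :: x) u v && ~~ mem2 (belast a x) u v)
     rw_prob e a x.

(** The law of the first time, 0 included, at which the walk from [a] is at [v]. *)
Definition hit_at (a : 'I_n) t : R :=
  \sum_(x : t.-tuple 'I_n | (v \in a :: x) && (v \notin belast a x))
     rw_prob e a x.

Lemma rw_prob_ge0 a t (x : t.-tuple 'I_n) : 0 <= rw_prob e a x :> R.
Proof.
rewrite /rw_prob; elim: (tval x) a => [|b s IHs] a /=.
  by rewrite big_nil.
by rewrite big_cons mulr_ge0// rw_step_ge0.
Qed.

Lemma hit_at_self t : hit_at v t = (t == 0)%:R.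
Proof.
case: t => [|t].
  rewrite /hit_at (big_pred1 [tuple]) => [|x].
    by rewrite /rw_prob/= big_nil.
  by rewrite tuple0 /= inE eqxx.
rewrite /hit_at big_pred0// => x.
by case/tupleP: x => b x; rewrite /= !inE eqxx.
Qed.

Lemma hit_at0 a : a != v -> hit_at a 0 = 0.
Proof.
move=> av; rewrite /hit_at big_pred0// => x.
by rewrite tuple0 /= inE eq_sym (negbTE av).
Qed.

Lemma hit_atS a t : a != v -> hit_at a t.+1 = \sum_b step a b * hit_at b t.
Proof.
move=> av; rewrite /hit_at.
rewrite (sum_tuple_cons t (fun x => (v \in a :: x) && (v \notin belast a x))
  (fun x => \prod_(q <- pairmap step a x) q)).
apply: eq_bigr => b _; rewrite mulr_sumr; apply: eq_big => x.
  by rewrite /= !(in_cons a) !(eq_sym v a) (negbTE av).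
by rewrite /= big_cons.
Qed.

(** From [u] on, only the return leg to [v] remains. *)
Lemma round_trip_at_hit t : round_trip_at u t = hit_at u t.
Proof.
rewrite /round_trip_at /hit_at; apply: eq_bigl => x.
rewrite mem2_cons eqxx; case: t x => [|t] x; first by rewrite tuple0.
by case/tupleP: x => b x; rewrite /= mem2_cons eqxx.
Qed.

Lemma round_trip_at0 a : a != u -> round_trip_at a 0 = 0.
Proof.
move=> au; rewrite /round_trip_at big_pred0// => x.
by rewrite tuple0 /= mem2_seq1 eq_sym (negbTE au).
Qed.

Lemma round_trip_atS a t : a != u ->
  round_trip_at a t.+1 = \sum_b step a b * round_trip_at b t.
Proof.
move=> au; rewrite /round_trip_at.
rewrite (sum_tuple_cons t
  (fun x => mem2 (a :: x) u v && ~~ mem2 (belast a x) u v)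
  (fun x => \prod_(q <- pairmap step a x) q)).
apply: eq_bigr => b _; rewrite mulr_sumr; apply: eq_big => x.
  by rewrite /= !(mem2_cons a) (negbTE au).
by rewrite /= big_cons.
Qed.

(* A Lyapunov argument: c a is the law of a stopping time for a walk started at
   a, and H a supersolution of the equation of its expectation. The bound on the
   total mass is what makes the induction on the horizon k go through. *)
Lemma truncated_expectation (c : 'I_n -> nat -> R) (H : 'I_n -> R)
    (stop : pred 'I_n) :
    (forall a, 0 <= H a) ->
    (forall a, ~~ stop a -> c a 0 = 0) ->
    (forall a t, ~~ stop a -> c a t.+1 = \sum_b step a b * c b t) ->
    (forall a, ~~ stop a -> 1 + \sum_b step a b * H b <= H a) ->
    (forall a k, stop a -> \sum_(0 <= t < k) c a t <= 1) ->
    (forall a k, stop a -> \sum_(0 <= t < k) t%:R * c a t <= H a) ->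
  (forall a k, \sum_(0 <= t < k) c a t <= 1) /\
  (forall a k, \sum_(0 <= t < k) t%:R * c a t <= H a).
Proof.
move=> H_ge0 c0 cS HS stop1 stopH.
have total a k : \sum_(0 <= t < k) c a t <= 1.
  elim: k a => [|k IHk] a; first by rewrite big_geq.
  have [sa|nsa] := boolP (stop a); first exact: stop1.
  rewrite big_nat_recl// c0// add0r.
  under eq_bigr do rewrite cS//.
  rewrite exchange_big/= -(sum_rw_step a) ler_sum// => b _.
  by rewrite -mulr_sumr ler_piMr ?rw_step_ge0.
split=> // a k; elim: k a => [|k IHk] a; first by rewrite big_geq.
have [sa|nsa] := boolP (stop a); first exact: stopH.
rewrite big_nat_recl// mul0r add0r (le_trans _ (HS a nsa))//.
under eq_bigr do rewrite cS// mulr_sumr.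
rewrite exchange_big/= -[X in X + _](sum_rw_step a) -big_split/=.
rewrite ler_sum// => b _.
rewrite (eq_bigr (fun t => step a b * c b t + step a b * (t%:R * c b t))).
  rewrite big_split/= -!mulr_sumr lerD//.
    by rewrite ler_piMr ?rw_step_ge0.
  by rewrite ler_wpM2l ?rw_step_ge0.
by move=> t _; rewrite -natr1; ring.
Qed.

(** [Hu] and [Hv] dominate the expected times to reach [u] and [v]. Supersolutions suffice since
    only an upper bound on the commute time is needed. *)
Lemma commute_time_le (Hu Hv : 'I_n -> R) :
    (forall a, 0 <= Hu a) -> (forall a, 0 <= Hv a) ->
    (forall a, a != u -> 1 + \sum_b step a b * Hu b <= Hu a) ->
    (forall a, a != v -> 1 + \sum_b step a b * Hv b <= Hv a) ->
  (commute_time e v u <= (Hu v + Hv u)%:E)%E.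
Proof.
move=> Hu0 Hv0 HuS HvS.
have [hit1 hitH] : (forall a k, \sum_(0 <= t < k) hit_at a t <= 1) /\
    (forall a k, \sum_(0 <= t < k) t%:R * hit_at a t <= Hv a).
  apply: (truncated_expectation (stop := pred1 v)) => //= [a|a t|a k|a k].
  - exact: hit_at0.
  - exact: hit_atS.
  - move/eqP->; under eq_bigr do rewrite hit_at_self.
    case: k => [|k]; first by rewrite big_geq.
    by rewrite big_nat_recl// big1 ?addr0.
  - move/eqP->; rewrite big1 // => t _.
    by rewrite hit_at_self; case: t => [|t]; rewrite ?mul0r ?mulr0.
(* The supersolution for the round trip adds to [Hu] the constant cost [Hv u] of the return leg; the
   constant is preserved by averaging over a step. *)
have [_ tripH] : (forall a k, \sum_(0 <= t < k) round_trip_at a t <= 1) /\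
    (forall a k, \sum_(0 <= t < k) t%:R * round_trip_at a t <= Hu a + Hv u).
  apply: (truncated_expectation (stop := pred1 u)) => //=
      [a|a|a t|a au|a k|a k].
  - by rewrite addr_ge0.
  - exact: round_trip_at0.
  - exact: round_trip_atS.
  - under eq_bigr do rewrite mulrDr.
    by rewrite big_split/= -mulr_suml sum_rw_step mul1r addrA lerD2r HuS.
  - by move/eqP->; under eq_bigr do rewrite round_trip_at_hit.
  - move/eqP->; under eq_bigr do rewrite round_trip_at_hit.
    by rewrite (le_trans (hitH _ _))// lerDr.
apply: lime_le.
  apply: is_cvg_nneseries => t _ _.
  by rewrite lee_fin mulr_ge0// sumr_ge0// => x _; exact: rw_prob_ge0.
by apply: nearW => k; rewrite sumEFin lee_fin tripH.
Qed.

End CommuteTime.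

(** * Comparison of the over-squashing proxy with a lazy walk *)

Lemma opnorm_ge0 (R : realType) p q (M : 'M[R]_(p, q)) : 0 <= opnorm M.
Proof.
rewrite /opnorm; set S := [set _ | _ in _].
(* [sup] has the default value 0 on a set without supremum; otherwise the zero vector shows that it
   is nonnegative. *)
have [supS|/sup_out->//] := pselect (has_sup S).
have S0 : S 0.
  exists 0; last first.
    by rewrite mulmx0 /l2norm big1 ?sqrtr0// => i _; rewrite mxE expr0n.
  by rewrite /= /l2norm big1 ?sqrtr0// => i _; rewrite mxE expr0n.
exact: (ub_le_sup supS.2 S0).
Qed.

(** * Entrywise domination of nonnegative matrices *)

Section EntrywiseOrder.
Context {R : realType}.

(** Nonnegativity of the smaller matrix is built in so that products preserve the relation. *)
Definition mxle p q (M N : 'M[R]_(p, q)) := forall i j, 0 <= M i j <= N i j.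

Lemma mxle_refl p q (M : 'M[R]_(p, q)) : (forall i j, 0 <= M i j) -> mxle M M.
Proof. by move=> M0 i j; rewrite M0 lexx. Qed.

Lemma mxle_mul p q r (M M' : 'M[R]_(p, q)) (N N' : 'M[R]_(q, r)) :
  mxle M M' -> mxle N N' -> mxle (M *m N) (M' *m N').
Proof.
move=> MM NN i j; rewrite !mxE; apply/andP; split.
  apply: sumr_ge0 => k _.
  by have /andP[? _] := MM i k; have /andP[? _] := NN k j; rewrite mulr_ge0.
apply: ler_sum => k _; have /andP[? ?] := MM i k; have /andP[? ?] := NN k j.
by rewrite ler_pM.
Qed.

Lemma mxle_exp n (M N : 'M[R]_n) k : mxle M N -> mxle (M ^+ k) (N ^+ k).
Proof.
move=> MN; elim: k => [|k IHk]; last by rewrite !exprS; exact: mxle_mul.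
rewrite !expr0; apply: mxle_refl => i j.
by rewrite [X in _ <= X]mxE ler0n.
Qed.

Lemma mxle_tr p q (M N : 'M[R]_(p, q)) : mxle M N -> mxle M^T N^T.
Proof. by move=> MN i j; rewrite !mxE. Qed.

Lemma mxle_diag n (c : 'rV[R]_n) (kappa : R) :
  (forall i, 0 <= c 0 i <= kappa) -> mxle (diag_mx c) kappa%:M.
Proof.
move=> ck i j; rewrite !mxE; case: eqP => [_|_]; last by rewrite !mulr0n lexx.
by rewrite !mulr1n.
Qed.

Lemma tr_exp_mx n (M : 'M[R]_n) k : (M ^+ k)^T = M^T ^+ k.
Proof.
elim: k => [|k IHk]; first by rewrite !expr0 tr_scalar_mx.
by rewrite exprS trmx_mul IHk exprSr.
Qed.

End EntrywiseOrder.

(** * Bounds on the proxy by powers of the lazy walk *)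

Section OverSquashingBound.
Context {R : realType} {n : nat} (e : rel 'I_n).
Hypotheses (e_simple : simple_graph e) (e_conn : connected_graph e)
  (e_nonbip : ~ bipartite e).
Context (m : nat) (omega w c1 c2 cH : R).
Hypotheses (omega_ge0 : 0 <= omega) (w_gt0 : 0 < w) (w_le1 : w <= 1)
  (c1_ge0 : 0 <= c1) (c2_gt0 : 0 < c2) (cH_ge0 : 0 <= cH)
  (small : omega / w + c1 * degree_ratio e + c2 <= 1).

Local Notation sd := (@sqrt_deg R _ e).
Local Notation A := (sym_adjacency e : 'M[R]_n).
Local Notation gamma := (degree_ratio e : R).
Local Notation S := (osq_S A omega w c1 c2).

(* In terms of the normalized Laplacian L, this is I - c2 L; the smallness
   hypothesis makes it an entrywise upper bound for S. *)
Definition lazy_walk : 'M[R]_n := (1 - c2)%:M + c2 *: A.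
Local Notation T := lazy_walk.

Lemma lazy_rate_le1 (v : 'I_n) : c2 <= 1.
Proof.
apply: le_trans small; rewrite lerDr addr_ge0 ?divr_ge0 ?(ltW w_gt0)//.
by rewrite mulr_ge0// (le_trans ler01)// (degree_ratio_ge1 e_conn e_nonbip v).
Qed.

(** [A] fixes [sd], whose entries are at least the square root of the minimal degree; dividing by
    that root bounds the row sum. *)
Lemma row_sums_bounds v : 0 <= row_sums A 0 v <= gamma.
Proof.
have -> : row_sums A 0 v = \sum_u A v u.
  by rewrite !mxE; apply: eq_bigr => u _; rewrite [X in _ * X]mxE mulr1.
rewrite sumr_ge0/= => [|u _]; last exact: sym_adjacency_ge0.
apply: le_trans (sqrt_deg_ratio_min_le e v).
rewrite ler_pdivlMr ?(sqrt_min_deg_gt0 e_conn e_nonbip v)//.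
rewrite -[leRHS](sqrt_deg_sym_adjacency e_conn e_nonbip) mulr_suml.
rewrite ler_sum// => u _.
by rewrite ler_wpM2l ?sym_adjacency_ge0 ?sqrt_min_deg_le.
Qed.

Lemma tr_lazy_walk : T^T = T.
Proof. by rewrite linearD/= linearZ/= tr_scalar_mx tr_sym_adjacency. Qed.

Lemma lazy_walkE v u : T v u = (1 - c2) * (v == u)%:R + c2 * A v u.
Proof. by rewrite /lazy_walk; move: (A) => B; rewrite !mxE mulr_natr.
Qed.

(** The off-diagonal entries agree; on the diagonal, [small] bounds [omega / w] plus [c1] times a
    row sum by [1 - c2]. *)
Lemma osq_S_le : mxle S T.
Proof.
move=> v u; rewrite lazy_walkE.
have -> : S v u = (omega / w + c1 * row_sums A 0 v) * (v == u)%:R + c2 * A v u.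
  rewrite /osq_S; move: (row_sums A) (A) => rs B.
  by rewrite !mxE; case: eqP => _; rewrite ?mulr1n ?mulr0n; ring.
have /andP[r0 r1] := row_sums_bounds v.
have A0 := sym_adjacency_ge0 (R := R) e v u.
rewrite addr_ge0/= ?lerD2r.
- rewrite ler_wpM2r// lerBrDr (le_trans _ small)// lerD2r lerD2l.
  by rewrite ler_wpM2l.
- by rewrite mulr_ge0// addr_ge0 ?divr_ge0 ?(ltW w_gt0)// mulr_ge0.
- by rewrite mulr_ge0// ltW.
Qed.

Lemma lazy_walk_exp_ge0 k v u : 0 <= (T ^+ k) v u.
Proof. by have /andP[/le_trans/[apply]] := mxle_exp k osq_S_le v u. Qed.

Lemma mxle_adjacency : mxle A A.
Proof. by apply: mxle_refl => v u; exact: sym_adjacency_ge0. Qed.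

(* A left fixed vector of A, hence of the lazy walk, that dominates the all-ones
   vector: this is what bounds the column sums of the powers of S by gamma. *)
Let stat : 'rV[R]_n := \row_v (sd v / Num.sqrt (min_deg e)%:R).

Lemma stat_adjacency : stat *m A = stat.
Proof.
apply/rowP => v; rewrite !mxE.
rewrite -[in RHS](sqrt_deg_sym_adjacency e_conn e_nonbip) mulr_suml.
apply: eq_bigr => u _; rewrite mxE -[in RHS](tr_sym_adjacency e_simple).
by rewrite [in RHS]mxE; ring.
Qed.

Lemma stat_lazy_walk k : stat *m T ^+ k = stat.
Proof.
elim: k => [|k IHk]; first by rewrite expr0 mulmx1.
rewrite exprS mulmxA mulmxDr mul_mx_scalar -scalemxAr stat_adjacency.
by rewrite -scalerDl subrK scale1r.
Qed.

Lemma col_sums_le k : mxle (osq_col_sums A omega w c1 c2 k) stat.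
Proof.
rewrite -(stat_lazy_walk k); apply: mxle_mul; last exact: mxle_exp osq_S_le.
have dmin0 := sqrt_min_deg_gt0 (R := R) e_conn e_nonbip.
move=> i v; rewrite !mxE ler01/= ler_pdivlMr ?(dmin0 v)// mul1r.
exact: sqrt_min_deg_le.
Qed.

Lemma stat_le v : stat 0 v <= gamma.
Proof. by rewrite mxE sqrt_deg_ratio_min_le. Qed.

Lemma col_sums_bounds k v : 0 <= osq_col_sums A omega w c1 c2 k 0 v <= gamma.
Proof.
by have /andP[-> h] := col_sums_le k 0 v; rewrite (le_trans h)// stat_le.
Qed.

(** The diagonal part contributes at most [gamma * gamma]; in the part with [A], domination by the
    fixed vector [stat] costs only one [gamma]. *)
Lemma weighted_col_sums_bounds k v :
  0 <= (osq_col_sums A omega w c1 c2 k *m (diag_mx (row_sums A) + A)) 0 v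
    <= gamma * (1 + gamma).
Proof.
have /andP[c0 c_le] := col_sums_bounds k v.
have /andP[r0 r_le] := row_sums_bounds v.
have /andP[a0 a_le] := mxle_mul (col_sums_le k) mxle_adjacency 0 v.
rewrite mulmxDr mul_mx_diag mxE [X in _ <= X + _ <= _]mxE.
rewrite addr_ge0 ?mulr_ge0//= mulrDr mulr1 addrC lerD//.
  by rewrite (le_trans a_le)// stat_adjacency stat_le.
by rewrite ler_pM.
Qed.

Lemma sandwich_le (c : 'rV[R]_n) kappa (X X' Y Y' : 'M[R]_n) :
    (forall i, 0 <= c 0 i <= kappa) -> mxle X X' -> mxle Y Y' ->
  forall v u, 0 <= (X^T *m diag_mx c *m Y) v u <= kappa * (X'^T *m Y') v u.
Proof.
move=> ck XX YY v u.
have := mxle_mul (mxle_mul (mxle_tr XX) (mxle_diag ck)) YY v u.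
by rewrite mul_mx_scalar -scalemxAl [X in _ <= _ <= X]mxE.
Qed.

Lemma adjacency_comm k : A *m T ^+ k = T ^+ k *m A.
Proof.
have cAT : A *m T = T *m A.
  rewrite mulmxDr mulmxDl -scalemxAr -scalemxAl.
  by rewrite scalar_mxC.
exact: (commrX k (cAT : GRing.comm A T)).
Qed.

Local Notation Ssq k :=
  ((S ^+ (m - k))^T *m diag_mx (osq_col_sums A omega w c1 c2 k)
    *m S ^+ (m - k)).

Lemma osq_term_main k v u : 0 <= Ssq k v u <= gamma * (T ^+ (2 * (m - k))) v u.
Proof.
have := sandwich_le (col_sums_bounds k) (mxle_exp (m - k) osq_S_le)
  (mxle_exp (m - k) osq_S_le) v u.
by rewrite [(T ^+ _)^T]tr_exp_mx tr_lazy_walk mul2n -addnn exprD.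
Qed.

Lemma osq_P_bounds k v u :
  0 <= osq_P A m omega w c1 c2 k v u <=
    gamma * (A *m T ^+ (2 * (m - k - 1))) v u.
Proof.
have := sandwich_le (col_sums_bounds k) (mxle_exp (m - k - 1) osq_S_le)
  (mxle_mul mxle_adjacency (mxle_exp (m - k - 1) osq_S_le)) v u.
rewrite [(T ^+ _)^T]tr_exp_mx tr_lazy_walk.
set a := (m - k - 1)%N.
have -> : T ^+ a *m (A *m T ^+ a) = A *m T ^+ (2 * a).
  by rewrite mulmxA -adjacency_comm -mulmxA mul2n -addnn exprD.
by [].
Qed.

Lemma tr_adjacency_lazy_walk k : (A *m T ^+ k)^T = A *m T ^+ k.
Proof.
by rewrite trmx_mul tr_exp_mx tr_lazy_walk tr_sym_adjacency// -adjacency_comm.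
Qed.

Lemma osq_Q_bounds k v u : 0 <= osq_Q A m omega w c1 c2 k v u <=
  gamma * (2 * (A *m T ^+ (2 * (m - k - 1))) v u
           + (1 + gamma) * (T ^+ (2 * (m - k - 1))) v u).
Proof.
have /andP[p0 p1] := osq_P_bounds k v u.
have /andP[p0' p1'] := osq_P_bounds k u v.
have := sandwich_le (weighted_col_sums_bounds k)
  (mxle_exp (m - k - 1) osq_S_le) (mxle_exp (m - k - 1) osq_S_le) v u.
rewrite [(T ^+ _)^T]tr_exp_mx tr_lazy_walk => /andP[q0 q1].
rewrite /osq_Q mxE [X in _ <= X + _ <= _]mxE [(osq_P _ _ _ _ _ _ _)^T _ _]mxE.
rewrite !addr_ge0//= mulrDr mulrA lerD//.
  rewrite mulr2n mulrDr mulrDl mulr1 lerD//.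
  (* The transposed summand has the same bound because [A *m T ^+ k] is symmetric. *)
  by rewrite -[in leRHS]tr_adjacency_lazy_walk [in leRHS]mxE.
by rewrite mulrA (le_trans q1)// mul2n -addnn exprD.
Qed.

Lemma osq_sum_le v u : osq_sum A m omega w c1 c2 cH v u <=
  gamma * (\sum_(0 <= k < m) (T ^+ (2 * (m - k))) v u
    + cH * \sum_(0 <= k < m) (2 * (A *m T ^+ (2 * (m - k - 1))) v u
                 + (1 + gamma) * (T ^+ (2 * (m - k - 1))) v u)).
Proof.
rewrite mulrDr mulrCA !mulr_sumr -big_split/= /osq_sum [leLHS]big_nat_cond.
rewrite [leRHS]big_nat_cond; apply: ler_sum => k /andP[/andP[_ km] _].
rewrite mxE [X in _ * (X + _)]mxE [X in _ * (_ + X)]mxE.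
have /andP[s0 s1] := osq_term_main k v u.
have /andP[q0 q1] := osq_Q_bounds k v u.
have w1 : w ^+ (2 * m - k - 1) <= 1 by rewrite exprn_ile1// ltW.
apply: (@le_trans _ _ (1 * (Ssq k v u + cH * osq_Q A m omega w c1 c2 k v u))).
  rewrite ler_pM ?exprn_ge0 ?(ltW w_gt0)//.
    by rewrite addr_ge0 ?mulr_ge0 ?(ltW w_gt0).
  by rewrite lerD2r ler_piMl.
by rewrite mul1r lerD// ler_wpM2l.
Qed.

Lemma osq_sum_ge0 v u : 0 <= osq_sum A m omega w c1 c2 cH v u.
Proof.
apply: sumr_ge0 => k _; have /andP[s0 _] := osq_term_main k v u.
have /andP[q0 _] := osq_Q_bounds k v u.
rewrite mxE [X in _ * (X + _)]mxE [X in _ * (_ + X)]mxE.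
by rewrite mulr_ge0 ?exprn_ge0 ?addr_ge0 ?mulr_ge0 ?(ltW w_gt0).
Qed.

End OverSquashingBound.

(** * Green function and sums of powers of the lazy walk *)

Lemma num_nodes_gt1 n (e : rel 'I_n.+1) :
  simple_graph e -> ~ bipartite e -> (0 < n)%N.
Proof.
case: n e => // e e_simple e_nonbip; case: e_nonbip; exists xpredT => a b.
by rewrite !ord1 e_simple.2.
Qed.

Section SpectralBounds.
Context {R : realType} {n : nat} (e : rel 'I_n.+1).
Hypotheses (e_simple : simple_graph e) (e_conn : connected_graph e)
  (e_nonbip : ~ bipartite e).
Context (lam : seq R) (P : 'M[R]_n.+1).
Hypotheses (lam_spec : is_spectrum (normalized_laplacian e) lam)
  (PPT : P *m P^T = 1%:M)
  (LP : normalized_laplacian e = P^T *m diag_mx (\row_i lam`_i) *m P).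
Context (c2 : R).
Hypotheses (c2_gt0 : 0 < c2) (c2_le1 : c2 <= 1).

Local Notation sd := (@sqrt_deg R _ e).
Local Notation A := (sym_adjacency e : 'M[R]_n.+1).
Local Notation E := ((num_edges e)%:R : R).
Local Notation gamma := (degree_ratio e : R).
Local Notation T := (lazy_walk e c2).

(* Entries of the projection onto the kernel of the Laplacian. *)
Definition stationary v u : R := sd v * sd u / (2 * E).

(* Entries of the pseudo-inverse of the Laplacian. *)
Definition green v u : R := \sum_(l | l != ord0) P l v * P l u / lam`_l.

Let sd0 v : sd v != 0 := sqrt_deg_neq0 e_conn e_nonbip v.
Let sdp v : 0 < sd v := sqrt_deg_gt0 e_conn e_nonbip v.

Lemma num_edgesr_gt0 : 0 < E.
Proof. by rewrite ltr0n (num_edges_gt0 e_simple e_conn e_nonbip ord0). Qed.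

Lemma stationary_gt0 v u : 0 < stationary v u.
Proof. by rewrite divr_gt0 ?mulr_gt0 ?num_edgesr_gt0. Qed.

Lemma green_sym v u : green v u = green u v.
Proof. by apply: eq_bigr => l _; rewrite [P l v * _]mulrC. Qed.

Lemma excited_complete v u :
  \sum_(l | l != ord0) P l v * P l u = (v == u)%:R - stationary v u.
Proof.
rewrite /stationary.
rewrite -(harmonic_projectionE e_simple e_conn e_nonbip lam_spec PPT LP).
rewrite -(eigenvector_complete PPT) [X in _ = X - _](bigD1 ord0)//=.
by rewrite addrAC subrr add0r.
Qed.

(** The bound [2ab <= a^2 + b^2] reduces to diagonal entries; the slack is the square
    [(sd v - sd u) ^+ 2 / (4 * E)]. *)
Lemma excited_abs_le v u :
  \sum_(l | l != ord0) `|P l v * P l u| <= 1 - stationary v u.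
Proof.
have h a : \sum_(l | l != ord0) P l a ^+ 2 = 1 - stationary a a.
  by under eq_bigr do rewrite expr2; rewrite excited_complete eqxx.
apply: (@le_trans _ _ (\sum_(l | l != ord0) (P l v ^+ 2 + P l u ^+ 2) / 2)).
  apply: ler_sum => l _; rewrite normrM.
  have := sqr_ge0 (`|P l v| - `|P l u|).
  rewrite -[P l v ^+ 2]real_normK ?num_real//.
  rewrite -[P l u ^+ 2]real_normK ?num_real//.
  by nra.
rewrite -mulr_suml big_split/= !h /stationary.
have E0 := num_edgesr_gt0; rewrite -subr_ge0.
rewrite (_ : _ - _ = (sd v - sd u) ^+ 2 / (4 * E)).
  by rewrite divr_ge0 ?sqr_ge0// mulr_ge0// ltW.
by field; rewrite gt_eqF.
Qed.

Local Notation x l := (1 - c2 * lam`_l).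

Lemma lazy_walk_expE k v u :
  (T ^+ k) v u = \sum_(l < n.+1) x l ^+ k * (P l v * P l u).
Proof.
elim: k v => [|k IHk] v.
  rewrite expr0 [LHS]mxE -(eigenvector_complete PPT).
  by apply: eq_bigr => l _; rewrite expr0 mul1r.
rewrite exprS mxE.
under eq_bigr do rewrite IHk mulr_sumr.
rewrite exchange_big/=; apply: eq_bigr => l _.
rewrite (eq_bigr (fun a => x l ^+ k * P l u * ((1 - c2) * ((v == a)%:R * P l a)
  + c2 * (A v a * P l a)))) => [|a _]; last by rewrite lazy_walkE; ring.
rewrite -mulr_sumr big_split/= -!mulr_sumr (eigenvectorE e_simple PPT LP).
rewrite (bigD1 v)//= big1 => [|a av]; last by rewrite eq_sym (negbTE av) mul0r.
by rewrite eqxx mulr1n exprS; ring.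
Qed.

Lemma lazy_walk_sumE b v u : \sum_(0 <= k < b) (T ^+ k) v u =
  b%:R * stationary v u + green v u / c2
  - \sum_(l | l != ord0) x l ^+ b * (P l v * P l u) / (c2 * lam`_l).
Proof.
under eq_bigr do rewrite lazy_walk_expE.
rewrite exchange_big/= (bigD1 ord0)//=.
rewrite (spectrum0 e_simple e_conn e_nonbip lam_spec PPT LP) mulr0 subr0.
under eq_bigr do rewrite expr1n mul1r.
rewrite -addrA; congr (_ + _).
  rewrite sumr_const_nat subn0.
  rewrite (harmonic_projectionE e_simple e_conn e_nonbip lam_spec PPT LP).
  by rewrite -/(stationary v u) mulr_natl.
rewrite /green mulr_suml -sumrB; apply: eq_bigr => l l0.
have lam0 := spectrum_gt0 e_simple e_conn e_nonbip lam_spec PPT LP l0.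
rewrite -mulr_suml big_mkord.
have /eqP := subrX1 (x l) b.
rewrite (_ : x l - 1 = - (c2 * lam`_l)); last by ring.
move=> /eqP xb.
have -> : \sum_(i < b) x l ^+ i = (1 - x l ^+ b) / (c2 * lam`_l).
  have -> : 1 - x l ^+ b = c2 * lam`_l * \sum_(i < b) x l ^+ i.
    by rewrite -[LHS]opprB xb mulNr opprK.
  by rewrite [RHS]mulrAC divff ?mul1r// gt_eqF// mulr_gt0.
by field; rewrite !gt_eqF.
Qed.

(** The Laplacian times its pseudo-inverse is the projection off the kernel. *)
Lemma green_poisson a u : \sum_b A a b * green b u =
  green a u - ((a == u)%:R - stationary a u).
Proof.
under eq_bigr do rewrite mulr_sumr.
rewrite exchange_big/= -excited_complete -sumrB; apply: eq_bigr => l l0.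
have lam0 := spectrum_gt0 e_simple e_conn e_nonbip lam_spec PPT LP l0.
rewrite (eq_bigr (fun b => (A a b * P l b) * (P l u / lam`_l))) => [|b _].
  by rewrite -mulr_suml (eigenvectorE e_simple PPT LP); field; rewrite gt_eqF.
by ring.
Qed.

(* Closed form of the expected time to reach u from a. *)
Definition hitting_time u a : R :=
  2 * E * (green u u / sd u ^+ 2 - green a u / (sd a * sd u)).

(** Away from [u], the source left in the Poisson equation is the kernel entry, which the prefactor
    [2 * E / (sd a * sd u)] normalizes to 1. *)
Lemma hitting_time_step u a : a != u ->
  1 + \sum_b rw_step e a b * hitting_time u b = hitting_time u a.
Proof.
move=> au; have E0 := num_edgesr_gt0.
rewrite (eq_bigr (fun b => rw_step e a b * (2 * E * (green u u / sd u ^+ 2))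
  - (2 * E / (sd a * sd u)) * (A a b * green b u))) => [|b _].
  rewrite sumrB -mulr_suml (sum_rw_step e_conn e_nonbip) -mulr_sumr.
  rewrite green_poisson.
  rewrite (negbTE au) /hitting_time /stationary mulr0n; field.
  by rewrite !sd0 gt_eqF.
rewrite /hitting_time /rw_step sym_adjacencyE -sqr_sqrt_deg; field.
by rewrite !sd0.
Qed.

Lemma hitting_time_self u : hitting_time u u = 0.
Proof. by rewrite /hitting_time expr2 subrr mulr0. Qed.

(** Minimum principle: a minimum away from [u] would contradict the one-step equation, so the
    minimum is the value 0 at [u]. *)
Lemma hitting_time_ge0 u a : 0 <= hitting_time u a.
Proof.
have [a0 _ a0_min] :=
  @Order.TotalTheory.arg_minP _ _ _ ord0 predT (hitting_time u) isT.
apply: le_trans (a0_min a isT).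
have [->|a0u] := eqVneq a0 u; first by rewrite hitting_time_self.
have : 1 + \sum_b rw_step e a0 b * hitting_time u a0 <= hitting_time u a0.
  rewrite -[leRHS](hitting_time_step a0u) lerD2l ler_sum// => b _.
  by rewrite ler_wpM2l ?rw_step_ge0// a0_min.
by rewrite -mulr_suml (sum_rw_step e_conn e_nonbip) mul1r gerDr ler10.
Qed.

Lemma commute_time_hitting v u :
  (commute_time e v u <= (hitting_time u v + hitting_time v u)%:E)%E.
Proof.
apply: commute_time_le => // a; do ?exact: hitting_time_ge0.
- by move=> au; rewrite hitting_time_step.
- by move=> av; rewrite hitting_time_step.
Qed.

Lemma lam1_gt0 : (0 < n)%N -> 0 < lam`_1.
Proof.
move=> n0; have n1 : (1 < n.+1)%N by [].
exact: (spectrum_gt0 e_simple e_conn e_nonbip lam_spec PPT LP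
  (l := Ordinal n1)).
Qed.

Lemma lam1_le (l : 'I_n.+1) : l != ord0 -> lam`_1 <= lam`_l.
Proof.
move=> l0; apply: (spectrum_nondecreasing lam_spec).
by rewrite ltn_ord andbT lt0n.
Qed.

Let lam1 : 0 < lam`_1 := lam1_gt0 (num_nodes_gt1 e_simple e_nonbip).

Lemma green_diag_le v : green v v <= (1 - stationary v v) / lam`_1.
Proof.
rewrite (_ : 1 - _ = \sum_(l | l != ord0) P l v * P l v); last first.
  by rewrite excited_complete eqxx.
rewrite mulr_suml.
apply: ler_sum => l l0.
have l1 := lam1_le l0.
by rewrite ler_wpM2l ?sqr_ge0// lef_pV2 ?posrE ?(lt_le_trans lam1).
Qed.

Lemma hitting_time_sumE v u :
  (hitting_time u v + hitting_time v u) * stationary v u / 2 =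
  (green u u * (sd v / sd u) + green v v * (sd u / sd v)) / 2 - green v u.
Proof.
rewrite /hitting_time /stationary (green_sym u v).
have E0 := num_edgesr_gt0.
by field; rewrite !sd0 gt_eqF.
Qed.

Lemma green_le v u : green v u <=
  (gamma - stationary v u) / lam`_1
  - (hitting_time u v + hitting_time v u) * stationary v u / 2.
Proof.
rewrite hitting_time_sumE.
have E0 := num_edgesr_gt0.
have gv : green u u * (sd v / sd u)
    <= (1 - stationary u u) / lam`_1 * (sd v / sd u).
  by rewrite ler_wpM2r ?green_diag_le// divr_ge0// ltW.
have gu : green v v * (sd u / sd v)
    <= (1 - stationary v v) / lam`_1 * (sd u / sd v).
  by rewrite ler_wpM2r ?green_diag_le// divr_ge0// ltW.
have := lerD gv gu.
rewrite (_ : (1 - stationary u u) / lam`_1 * (sd v / sd u)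
    + (1 - stationary v v) / lam`_1 * (sd u / sd v) =
  (sd v / sd u + sd u / sd v - 2 * stationary v u) / lam`_1); last first.
  by rewrite /stationary; field; rewrite !sd0 !gt_eqF.
have r1 := sqrt_deg_ratio_le (R := R) e_conn e_nonbip v u.
have r2 := sqrt_deg_ratio_le (R := R) e_conn e_nonbip u v.
have : (sd v / sd u + sd u / sd v - 2 * stationary v u) / lam`_1 <=
   2 * ((gamma - stationary v u) / lam`_1).
  by rewrite mulrA ler_pM2r ?invr_gt0//; lra.
by lra.
Qed.

Context (beta : R).
Hypotheses (beta_ge0 : 0 <= beta) (beta_lt1 : beta < 1)
  (x_le : forall l : 'I_n.+1, l != ord0 -> `|x l| <= beta).

Lemma excited_remainder_le b v u :
  - \sum_(l | l != ord0) x l ^+ b * (P l v * P l u) / (c2 * lam`_l) <=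
  beta ^+ b * (1 - stationary v u) / (c2 * lam`_1).
Proof.
have c2lam1 : 0 < c2 * lam`_1 by rewrite mulr_gt0.
rewrite (le_trans (ler_norm _))// normrN (le_trans (ler_norm_sum _ _ _))//.
apply: (@le_trans _ _ (\sum_(l | l != ord0)
    beta ^+ b * `|P l v * P l u| / (c2 * lam`_1))); last first.
  rewrite -mulr_suml -mulr_sumr ler_pM2r ?invr_gt0// ler_wpM2l ?exprn_ge0//.
  exact: excited_abs_le.
apply: ler_sum => l l0; have l1 := lam1_le l0.
rewrite !normrM normrX normfV -!normrM ler_pM ?mulr_ge0 ?exprn_ge0 ?invr_ge0//.
  by rewrite ler_wpM2r// lerXn2r ?nnegrE// x_le.
have c2lam : c2 * lam`_1 <= c2 * lam`_l by rewrite ler_pM2l.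
rewrite ger0_norm ?(le_trans _ c2lam) ?(ltW c2lam1)//.
by rewrite lef_pV2 ?posrE// (lt_le_trans c2lam1).
Qed.

(* The Green function in lazy_walk_sumE is traded for the commute time; rho will
   be beta ^ (r - 1). *)
Definition walk_sum_bound (rho : R) m v u : R :=
  2 * m%:R * stationary v u
  - (hitting_time u v + hitting_time v u) * stationary v u / 2 / c2
  + (gamma + rho) / (c2 * lam`_1).

Lemma walk_sum_le rho m v u :
    stationary v u * (c2 * lam`_1 - 1)
      + (1 - stationary v u) * beta ^+ (2 * m).+1 <= rho ->
  \sum_(0 <= k < (2 * m).+1) (T ^+ k) v u <= walk_sum_bound rho m v u.
Proof.
move=> rho_ge; rewrite lazy_walk_sumE.
have rem := excited_remainder_le (2 * m).+1 v u.
have green_c2 : green v u / c2 <= _ :=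
  ler_wpM2r (ltW (etrans (invr_gt0 c2) c2_gt0)) (green_le v u).
apply: le_trans (lerD (lerD (lexx _) green_c2) rem) _.
rewrite /walk_sum_bound -natr1 natrM.
set f := stationary v u in rho_ge *; set K := _ + hitting_time v u.
rewrite -subr_ge0 (_ : _ - _ = (rho - (f * (c2 * lam`_1 - 1)
    + (1 - f) * beta ^+ (2 * m).+1)) / (c2 * lam`_1)).
  by rewrite divr_ge0 ?subr_ge0// ltW// mulr_gt0.
by field; rewrite !gt_eqF.
Qed.

(** On the diagonal the spectral weights are squares, so the factors can be compared directly,
    without an extra power of the walk. *)
Lemma walk_sum_diag_le a m v : (a <= 1)%N ->
  \sum_(0 <= k < (2 * m)) (T ^+ (k + a)) v v <=
    2 * m%:R * stationary v v + 1 / (c2 * lam`_1).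
Proof.
move=> a1.
have sumE : \sum_(0 <= k < 2 * m) (T ^+ (k + a)) v v =
   2 * m%:R * stationary v v
   + \sum_(l | l != ord0) (x l ^+ a - x l ^+ (2 * m + a)) / (c2 * lam`_l)
                          * P l v ^+ 2.
  have -> : \sum_(0 <= k < 2 * m) (T ^+ (k + a)) v v =
      \sum_(0 <= k < 2 * m + a) (T ^+ k) v v - \sum_(0 <= k < a) (T ^+ k) v v.
    rewrite (@big_cat_nat _ _ _ a 0 (2 * m + a))//= ?leq_addl//.
    rewrite addrAC subrr add0r -{2}[a]add0n big_addn addnK.
    by apply: eq_bigr.
  rewrite !lazy_walk_sumE natrD natrM.
  rewrite (_ : \sum_(l | l != ord0) (x l ^+ a - _) / _ * _ =
    \sum_(l | l != ord0) x l ^+ a * (P l v * P l v) / (c2 * lam`_l)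
    - \sum_(l | l != ord0)
        x l ^+ (2 * m + a) * (P l v * P l v) / (c2 * lam`_l)).
    by ring.
  by rewrite -sumrB; apply: eq_bigr => l l0; rewrite expr2; ring.
rewrite sumE lerD2l.
apply: (@le_trans _ _ (\sum_(l | l != ord0) (c2 * lam`_1)^-1 * P l v ^+ 2)).
  apply: ler_sum => l l0; rewrite ler_wpM2r ?sqr_ge0//.
  have l1 := lam1_le l0.
  have c2lam1 : 0 < c2 * lam`_1 by rewrite mulr_gt0.
  have c2lam : c2 * lam`_1 <= c2 * lam`_l by rewrite ler_pM2l.
  have x1 : `|x l| <= 1 by rewrite (le_trans (x_le l0))// ltW.
  rewrite -[leRHS]mul1r; apply: (@le_trans _ _ (1 / (c2 * lam`_l))).
    rewrite ler_pM2r ?invr_gt0 ?(lt_le_trans c2lam1)//.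
    (* The numerator is [x l ^+ a] times one minus an even power; that power lies in [0, 1], so a
       negative [x l] does no harm. *)
    rewrite addnC exprD exprM -{1}[x l ^+ a]mulr1 -mulrBr.
    have x2 : 0 <= (x l ^+ 2) ^+ m <= 1.
      rewrite exprn_ge0 ?sqr_ge0//= exprn_ile1 ?sqr_ge0//.
      by rewrite -real_normK ?num_real// exprn_ile1.
    have xa : x l ^+ a <= 1.
      by rewrite (le_trans (ler_norm _))// normrX exprn_ile1.
    have /andP[x20 x21] := x2; move: (x l ^+ a) (_ ^+ m) xa x20 x21 => p q.
    by nra.
  by rewrite !mul1r lef_pV2 ?posrE// (lt_le_trans c2lam1).
rewrite -mulr_sumr mulrC ler_pM2r ?invr_gt0 ?mulr_gt0//.
under eq_bigr do rewrite expr2.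
by rewrite excited_complete eqxx lerBlDr lerDl ltW ?stationary_gt0.
Qed.

Lemma lazy_walk_exp_le1 k v u : (T ^+ k) v u <= 1.
Proof.
rewrite lazy_walk_expE (le_trans (ler_norm _))//.
rewrite (le_trans (ler_norm_sum _ _ _))//.
apply: (@le_trans _ _ (\sum_(l < n.+1) `|P l v * P l u|)).
  apply: ler_sum => l _; rewrite normrM ler_piMl// normrX exprn_ile1//.
  have [->|l0] := eqVneq l ord0; last by rewrite (le_trans (x_le l0))// ltW.
  rewrite (spectrum0 e_simple e_conn e_nonbip lam_spec PPT LP).
  by rewrite mulr0 subr0 normr1.
rewrite (bigD1 ord0)//= -lerBrDl (le_trans (excited_abs_le v u))//.
rewrite (harmonic_projectionE e_simple e_conn e_nonbip lam_spec PPT LP).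
by rewrite ger0_norm// ltW// stationary_gt0.
Qed.

Lemma adjacency_lazy_walkE k v u :
  (A *m T ^+ k) v u = (T ^+ k) v u + ((T ^+ k.+1) v u - (T ^+ k) v u) / c2.
Proof.
have -> : T ^+ k.+1 = (1 - c2) *: T ^+ k + c2 *: (A *m T ^+ k).
  by rewrite exprS [LHS]mulmxDl mul_scalar_mx -scalemxAl.
move: (A *m T ^+ k) (T ^+ k) => B C; rewrite !mxE.
by field; rewrite gt_eqF.
Qed.

(** As [c2 A = T - (1 - c2) I], the difference between the two sums telescopes. *)
Lemma adjacency_lazy_walk_sumE b v u : \sum_(0 <= k < b) (A *m T ^+ k) v u =
  \sum_(0 <= k < b) (T ^+ k) v u + ((T ^+ b) v u - (v == u)%:R) / c2.
Proof.
under eq_bigr do rewrite adjacency_lazy_walkE.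
rewrite big_split/= -mulr_suml telescope_sumr//.
by rewrite expr0 [(1%:M) v u]mxE.
Qed.

(* Rayleigh quotient of sd u e_v - sd v e_u, which is orthogonal to the kernel
   of the Laplacian. *)
Lemma nonadjacent_lam1_le1 v u : v != u -> ~~ e v u -> lam`_1 <= 1.
Proof.
move=> vu evu.
pose y l := sd u * P l v - sd v * P l u.
have y0 : y ord0 = 0.
  have [b [_ Pb]] := harmonic_eigenvector e_simple e_conn e_nonbip PPT LP
    (l := ord0) (spectrum0 e_simple e_conn e_nonbip lam_spec PPT LP).
  by rewrite /y !Pb; ring.
have bil p q : \sum_(l < n.+1) lam`_l * (P l p * P l q) = (p == q)%:R - A p q.
  rewrite -(eigenvector_complete PPT).
  have -> : A p q = \sum_a A p a * \sum_l P l a * P l q.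
    under eq_bigr do rewrite (eigenvector_complete PPT).
    rewrite (bigD1 q)//= big1 => [|a aq]; last by rewrite (negbTE aq) mulr0.
    by rewrite eqxx mulr1 addr0.
  under [X in _ = _ - X]eq_bigr do rewrite mulr_sumr.
  rewrite [X in _ = _ - X]exchange_big/= -sumrB; apply: eq_bigr => l _.
  under eq_bigr do rewrite mulrA.
  by rewrite -mulr_suml (eigenvectorE e_simple PPT LP); ring.
have Avu : A v u = 0 by rewrite sym_adjacencyE (negbTE evu) mul0r.
have Aself a : A a a = 0 by rewrite sym_adjacencyE e_simple.2 mul0r.
(* With [c = 1] completeness evaluates the sums, with [c = lam] the identity [bil] does. Both give
   [sd u ^+ 2 + sd v ^+ 2], so the Rayleigh quotient is exactly 1. *)
have quad (c : 'I_n.+1 -> R) : \sum_l c l * y l ^+ 2 =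
    sd u ^+ 2 * (\sum_l c l * (P l v * P l v))
    + sd v ^+ 2 * (\sum_l c l * (P l u * P l u))
    - 2 * (sd v * sd u) * (\sum_l c l * (P l v * P l u)).
  rewrite !mulr_sumr -big_split -sumrB/=; apply: eq_bigr => l _.
  by rewrite /y; ring.
have y2 : \sum_l y l ^+ 2 = sd u ^+ 2 + sd v ^+ 2.
  under eq_bigr do rewrite -[y _ ^+ 2]mul1r.
  rewrite (quad (fun=> 1)).
  under eq_bigr do rewrite mul1r.
  under [X in _ + _ * X - _]eq_bigr do rewrite mul1r.
  under [X in _ - _ * X]eq_bigr do rewrite mul1r.
  by rewrite !(eigenvector_complete PPT) !eqxx (negbTE vu) !mulr1n mulr0n; ring.
have ly2 : \sum_(l < n.+1) lam`_l * y l ^+ 2 = sd u ^+ 2 + sd v ^+ 2.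
  rewrite (quad (fun l => lam`_l)) !bil !eqxx (negbTE vu) Avu !Aself.
  rewrite !mulr1n mulr0n.
  by ring.
have y2_gt0 : 0 < sd u ^+ 2 + sd v ^+ 2 by rewrite addr_gt0// exprn_gt0.
rewrite -(ler_pM2r y2_gt0) mul1r -{1}y2 -ly2 mulr_sumr.
apply: ler_sum => l _; have [->|l0] := eqVneq l ord0.
  by rewrite y0 expr0n !mulr0.
by rewrite ler_wpM2r ?sqr_ge0// lam1_le.
Qed.

Lemma stationary_le1 v u : stationary v u <= 1.
Proof.
rewrite -subr_ge0; apply: le_trans (excited_abs_le v u).
by rewrite sumr_ge0.
Qed.

Lemma spectral_gap_bound v u m (r : nat) :
    v != u -> (0 < r <= (2 * m).+1)%N -> (e v u -> r = 1)%N ->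
  stationary v u * (c2 * lam`_1 - 1)
    + (1 - stationary v u) * beta ^+ (2 * m).+1 <= beta ^+ r.-1.
Proof.
move=> vu /andP[r0 rm] er.
have f0 := stationary_gt0 v u; have f1 := stationary_le1 v u.
have pow_le k : (k <= (2 * m).+1)%N -> beta ^+ (2 * m).+1 <= beta ^+ k.
  by move=> km; rewrite ler_wiXn2l// ltW.
have f1' : 0 <= 1 - stationary v u by rewrite subr_ge0.
move: (beta ^+ (2 * m).+1) pow_le => p pow_le.
have [evu|nevu] := boolP (e v u).
  rewrite er//= expr0.
  have n1 : (1 < n.+1)%N by rewrite ltnS (num_nodes_gt1 e_simple e_nonbip).
  have := x_le (l := Ordinal n1) isT; rewrite ler_norml/= => /andP[xb _].
  have xb1 : c2 * lam`_1 - 1 <= beta by lra.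
  have := ler_wpM2l (ltW f0) xb1.
  have := ler_wpM2l f1' (pow_le 1%N isT).
  have b1 := beta_lt1; rewrite expr1 => h1 h2.
  by set f := stationary v u in h1 h2 *; nra.
have lam1_le1 := nonadjacent_lam1_le1 vu nevu.
have c2lam1 : c2 * lam`_1 - 1 <= 0 by rewrite subr_le0 mulr_ile1// ltW.
have := ler_wpM2l (ltW f0) c2lam1.
have := ler_wpM2l f1'
  (pow_le r.-1 (leq_trans (leq_pred _) rm)).
have := mulr_ge0 (ltW f0) (exprn_ge0 r.-1 beta_ge0).
by lra.
Qed.

End SpectralBounds.

(** * Lower bound on the depth *)

Section GraphDistance.
Context {n : nat} (e : rel 'I_n).

Lemma graph_dist_le v u (s : seq 'I_n) :
  path e v s -> last v s = u -> (graph_dist e v u <= size s)%N.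
Proof.
move=> vs su; rewrite leqNgt; apply/negP => lt_dist.
have dist_n : (graph_dist e v u <= n)%N.
  by rewrite (leq_trans (find_size _ _))// size_iota.
have := before_find 0%N lt_dist; rewrite nth_iota ?(leq_trans lt_dist)// add0n.
by move/existsP; apply; exists (in_tuple s); rewrite vs su eqxx.
Qed.

Lemma graph_dist_gt0 v u : v != u -> (0 < graph_dist e v u)%N.
Proof.
rewrite /graph_dist; case: n e v u => [|n'] e' v u vu; first by case: v vu.
rewrite /=; case: existsP => // -[s].
by rewrite tuple0 /= (negbTE vu).
Qed.

End GraphDistance.

(** The left side runs over the indices of parity [b] below [2 * m]; the other parity only adds
    nonnegative terms. *)
Lemma sum_same_parity_le (R : realType) (F : nat -> R) b m :
    (forall k, 0 <= F k) -> (b < 2)%N ->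
  \sum_(0 <= k < m) F (2 * (m - k - 1) + b)%N <= \sum_(0 <= k < 2 * m) F k.
Proof.
move=> F0 b2; elim: m => [|m IHm]; first by rewrite muln0 !big_geq.
rewrite big_nat_recl// mulnS add2n !big_nat_recr//= subn0 subn1 /=.
rewrite -addrA addrC lerD//.
by case: b b2 {IHm} => [|[|]]// _; rewrite ?addn0 ?addn1 ?lerDl ?lerDr.
Qed.

Section DepthBound.
Context {R : realType} {n : nat} (e : rel 'I_n.+1).
Hypotheses (e_simple : simple_graph e) (e_conn : connected_graph e)
  (e_nonbip : ~ bipartite e).
Context (lam : seq R) (P : 'M[R]_n.+1).
Hypotheses (lam_spec : is_spectrum (normalized_laplacian e) lam)
  (PPT : P *m P^T = 1%:M)
  (LP : normalized_laplacian e = P^T *m diag_mx (\row_i lam`_i) *m P).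
Context (m : nat) (omega w c1 c2 cH : R).
Hypotheses (omega_ge0 : 0 <= omega) (w_gt0 : 0 < w) (w_le1 : w <= 1)
  (c1_ge0 : 0 <= c1) (c2_gt0 : 0 < c2) (cH_ge0 : 0 <= cH)
  (small : omega / w + c1 * degree_ratio e + c2 <= 1).

Local Notation sd := (@sqrt_deg R _ e).
Local Notation A := (sym_adjacency e : 'M[R]_n.+1).
Local Notation E := ((num_edges e)%:R : R).
Local Notation gamma := (degree_ratio e : R).
Local Notation T := (lazy_walk e c2).
Local Notation mu := (1 + 2 * cH * (1 + gamma)).
Local Notation beta := (\big[Num.max/0]_(1 <= l < n.+1) `|1 - c2 * lam`_l|).
Local Notation osq_vu v u := (osq_sum A m omega w c1 c2 cH v u).

Let c2_le1 : c2 <= 1 :=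
  lazy_rate_le1 e_conn e_nonbip omega_ge0 w_gt0 c1_ge0 small ord0.

Let T_ge0 k v u : 0 <= (T ^+ k) v u :=
  lazy_walk_exp_ge0 e_conn e_nonbip omega_ge0 w_gt0 c1_ge0 c2_gt0 small k v u.

Lemma contraction_ge0 : 0 <= beta.
Proof. exact: bigmax_ge_id. Qed.

Lemma contraction_ge (l : 'I_n.+1) : l != ord0 -> `|1 - c2 * lam`_l| <= beta.
Proof.
move=> l0.
apply: (le_bigmax_seq 0 (nat_of_ord l) xpredT
  (fun l => `|1 - c2 * lam`_l|)) => //.
by rewrite mem_index_iota lt0n l0 ltn_ord.
Qed.

Lemma contraction_lt1 : beta < 1.
Proof.
rewrite big_nat_cond; apply: bigmax_lt => // l /andP[/andP[l0 ln] _].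
have l_neq0 : Ordinal ln != ord0 by rewrite -val_eqE /= -lt0n.
have lam_gt0 := spectrum_gt0 e_simple e_conn e_nonbip lam_spec PPT LP l_neq0.
have lam_lt2 := spectrum_lt2 e_simple e_conn e_nonbip PPT LP (Ordinal ln).
have c2lam0 : 0 < c2 * lam`_l by rewrite mulr_gt0.
have c2lam : c2 * lam`_l < 2.
  by rewrite (le_lt_trans _ lam_lt2)// ler_piMl// ltW.
by rewrite ltr_norml; apply/andP; split; lra.
Qed.

Lemma lazy_walk_exp_path k v u : (T ^+ k) v u != 0 ->
  exists s, [/\ path e v s, last v s = u & (size s <= k)%N].
Proof.
elim: k v => [|k IHk] v.
  rewrite expr0 [(1%:M) v u]mxE; have [->|_] := eqVneq v u.
    by exists [::].
  by rewrite mulr0n eqxx.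
rewrite exprS mxE => /eqP Tvu.
have [a Ta] : exists a, T v a * (T ^+ k) a u != 0.
  apply: contrapT => /forallNP T0; apply: Tvu; apply: big1 => a _.
  by apply/eqP/negPn/negP; exact: T0.
move: Ta; rewrite mulf_eq0 negb_or => /andP[Tva /IHk[s [as_ su sk]]].
have [va|va] := eqVneq v a; first by exists s; rewrite va ltnW.
exists (a :: s); split=> //=; rewrite as_ andbT.
move: Tva; rewrite lazy_walkE (negbTE va) mulr0 add0r sym_adjacencyE.
by apply: contraNT => /negbTE ->; rewrite mul0r mulr0.
Qed.

Lemma osq_sum_walks v u : osq_vu v u <=
  gamma * (\sum_(0 <= k < 2 * m) (T ^+ (k + 1)) v u
    + cH * (2 * \sum_(0 <= k < 2 * m) (A *m T ^+ k) v u
            + (1 + gamma) * \sum_(0 <= k < 2 * m) (T ^+ k) v u)).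
Proof.
have gamma1 := degree_ratio_ge1 (R := R) e_conn e_nonbip ord0.
have gamma0 : 0 <= gamma by rewrite (le_trans ler01).
have AT_ge0 k : 0 <= (A *m T ^+ k) v u.
  rewrite mxE sumr_ge0// => a _; rewrite mulr_ge0//.
  exact: sym_adjacency_ge0.
apply: le_trans (osq_sum_le e_simple e_conn e_nonbip m omega_ge0 w_gt0 w_le1
  c1_ge0 c2_gt0 cH_ge0 small v u) _.
rewrite ler_wpM2l// lerD//.
  (* The exponent [2 * (m - k)] is positive, so it is an odd index in the sum shifted by one. *)
  have := sum_same_parity_le m (fun k => T_ge0 (k + 1) v u) (ltnSn 1).
  apply: le_trans; rewrite big_nat_cond [leRHS]big_nat_cond.
  apply: ler_sum => k /andP[/andP[_ km] _].
  by rewrite (_ : 2 * (m - k) = 2 * (m - k - 1) + 1 + 1)%N//; lia.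
rewrite ler_wpM2l// big_split/= -!mulr_sumr lerD//.
  rewrite ler_wpM2l//; have := sum_same_parity_le m AT_ge0 (ltn0Sn 1).
  by apply: le_trans; apply: ler_sum => k _; rewrite addn0.
rewrite ler_wpM2l ?addr_ge0//.
have := sum_same_parity_le m (fun k => T_ge0 k v u) (ltn0Sn 1).
by apply: le_trans; apply: ler_sum => k _; rewrite addn0.
Qed.

(** If [u] were farther away, no walk power in the bound could reach it and the proxy sum would
    vanish. This allows comparing [beta ^+ (2 * m).+1] with [beta ^+ r.-1]. *)
Lemma graph_dist_le_depth v u : 0 < osq_vu v u ->
  (graph_dist e v u <= (2 * m).+1)%N.
Proof.
move=> osq_gt0; rewrite leqNgt; apply/negP => dist.
have T0 k : (k <= 2 * m)%N -> (T ^+ k) v u = 0.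
  move=> km; apply/eqP/negPn/negP => /lazy_walk_exp_path[s [vs su sk]].
  have := leq_trans (graph_dist_le vs su) (leq_trans sk km).
  by rewrite leqNgt (ltn_trans _ dist).
move: osq_gt0; apply/negP; rewrite -leNgt (le_trans (osq_sum_walks v u))//.
rewrite !big1_seq ?(mulr0, addr0)// => k; rewrite mem_index_iota => /andP[_ km].
- by rewrite T0// ltnW.
- rewrite (adjacency_lazy_walkE e c2_gt0) (T0 k (ltnW km)) (T0 k.+1 km).
  by rewrite subrr mul0r addr0.
- by rewrite T0// addn1.
Qed.

Local Notation bound v u :=
  (walk_sum_bound e lam P c2 (beta ^ ((graph_dist e v u)%:Z - 1)) m v u).

(** Integer exponents are needed because [r - 1 = -1] when [v = u]; in that case only this sign is
    used. *)
Lemma contraction_pow_ge0 (z : int) : 0 <= beta ^ z.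
Proof. exact: exprz_ge0 contraction_ge0. Qed.

Lemma walk_sums_le v u : 0 < osq_vu v u ->
  \sum_(0 <= k < 2 * m) (T ^+ k) v u <= bound v u /\
  \sum_(0 <= k < 2 * m) (T ^+ (k + 1)) v u <= bound v u.
Proof.
move=> osq_gt0.
have lam1 := lam1_gt0 e_simple e_conn e_nonbip lam_spec PPT LP
  (num_nodes_gt1 e_simple e_nonbip).
have [<-|vu] := eqVneq v u.
  have diag_le a : (a <= 1)%N ->
      \sum_(0 <= k < 2 * m) (T ^+ (k + a)) v v <= bound v v.
    move=> a1; have := walk_sum_diag_le e_simple e_conn e_nonbip lam_spec PPT LP
      c2_gt0 contraction_lt1 contraction_ge m v a1.
    move/le_trans; apply; rewrite /walk_sum_bound hitting_time_self.
    rewrite addr0 !mul0r subr0 lerD2l ler_pM2r ?invr_gt0 ?mulr_gt0//.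
    have g1 := degree_ratio_ge1 (R := R) e_conn e_nonbip v.
    by rewrite (le_trans g1)// lerDl contraction_pow_ge0.
  split; last exact: diag_le.
  by have := diag_le 0%N isT; under eq_bigr do rewrite addn0.
have r0 := graph_dist_gt0 e vu.
have rho_ge := spectral_gap_bound e_simple e_conn e_nonbip lam_spec PPT LP
  c2_gt0 c2_le1 contraction_ge0 contraction_lt1 contraction_ge vu.
have {}rho_ge : stationary e v u * (c2 * lam`_1 - 1)
    + (1 - stationary e v u) * beta ^+ (2 * m).+1
    <= beta ^ ((graph_dist e v u)%:Z - 1).
  have -> : (graph_dist e v u)%:Z - 1 = (graph_dist e v u).-1.
    by case: (graph_dist e v u) r0 => // r _; rewrite -addn1 PoszD addrK addn1.
  apply: rho_ge; first by rewrite r0 graph_dist_le_depth.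
  move=> evu; apply/eqP; rewrite eqn_leq r0 andbT.
  by apply: (@graph_dist_le _ e v u [:: u]) => //=; rewrite evu.
have := walk_sum_le e_simple e_conn e_nonbip lam_spec PPT LP c2_gt0
  contraction_ge0 contraction_ge rho_ge.
(* Both sums arise from the one with [2 * m + 1] terms by dropping its last or its first term. *)
rewrite -[in X in X -> _]/(bound v u) => le_bound; split.
  by apply: le_trans le_bound; rewrite big_nat_recr//= lerDl.
apply: le_trans le_bound; rewrite big_nat_recl// -[leLHS]add0r lerD//.
by apply: ler_sum => k _; rewrite addn1.
Qed.

Lemma depth_bound (M : R) v u : M <= osq_vu v u -> 0 < osq_vu v u ->
  (hitting_time e lam P u v + hitting_time e lam P v u) / (4 * c2)
  + E / Num.sqrt ((deg e v)%:R * (deg e u)%:R)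
    * (M / (gamma * mu)
       - c2^-1 * ((gamma + beta ^ ((graph_dist e v u)%:Z - 1)) / lam`_1
                  + 2 * (cH / mu)))
  <= m%:R.
Proof.
move=> M_le osq_gt0.
have [U0 U1] := walk_sums_le osq_gt0.
have gamma1 := degree_ratio_ge1 (R := R) e_conn e_nonbip v.
have lam1 := lam1_gt0 e_simple e_conn e_nonbip lam_spec PPT LP
  (num_nodes_gt1 e_simple e_nonbip).
have E0 := num_edgesr_gt0 (R := R) e_simple e_conn e_nonbip.
have sdv := sqrt_deg_gt0 (R := R) e_conn e_nonbip v.
have sdu := sqrt_deg_gt0 (R := R) e_conn e_nonbip u.
have gamma_gt0 : 0 < gamma by rewrite (lt_le_trans ltr01).
have mu_gt0 : 0 < mu.
  by rewrite ltr_wpDr// !mulr_ge0// addr_ge0// ltW.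
have S0_ge0 : 0 <= \sum_(0 <= k < 2 * m) (T ^+ k) v u.
  by apply: sumr_ge0 => k _; exact: T_ge0.
(* The telescoped boundary term is at most [c2^-1], as entries of walk powers are at most 1; this is
   the source of the term [2 * (cH / mu)]. *)
have AU0 : \sum_(0 <= k < 2 * m) (A *m T ^+ k) v u <= bound v u + c2^-1.
  rewrite (adjacency_lazy_walk_sumE e c2_gt0) lerD//.
  rewrite ler_pdivrMr// mulVf ?(gt_eqF c2_gt0)//.
  have := lazy_walk_exp_le1 e_simple e_conn e_nonbip lam_spec PPT LP
    contraction_lt1 contraction_ge (2 * m) v u.
  by apply: le_trans; rewrite gerBl.
have M_bound : M / (gamma * mu) <= bound v u + 2 * cH / (c2 * mu).
  rewrite ler_pdivrMr ?mulr_gt0//.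
  apply: le_trans M_le _; apply: le_trans (osq_sum_walks v u) _.
  have -> : (bound v u + 2 * cH / (c2 * mu)) * (gamma * mu) =
      gamma * (mu * bound v u + cH * (2 * c2^-1)).
    by field; rewrite !gt_eqF.
  rewrite ler_wpM2l ?(ltW gamma_gt0)//.
  have B0 := le_trans S0_ge0 U0.
  move: (bound v u) U0 U1 AU0 B0 => B U0 U1 AU0 B0.
  have h1 : 2 * \sum_(0 <= k < 2 * m) (A *m T ^+ k) v u
      + (1 + gamma) * \sum_(0 <= k < 2 * m) (T ^+ k) v u
      <= 2 * (B + c2^-1) + (1 + gamma) * B.
    by rewrite lerD ?ler_wpM2l// addr_ge0// ltW.
  apply: le_trans (lerD U1 (ler_wpM2l cH_ge0 h1)) _.
  (* The coefficient of [B] is [1 + cH * (3 + gamma)], at most [mu] because [gamma >= 1]. *)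
  have := mulr_ge0 (mulr_ge0 cH_ge0 B0) (etrans (subr_ge0 1 gamma) gamma1).
  by move: (c2^-1) => ic; lra.
rewrite sqrtrM ?ler0n// -/(sqrt_deg e v) -/(sqrt_deg e u).
(* This factor turns the kernel term [2 * m%:R * stationary v u] into [m%:R]. *)
have := ler_wpM2l (ltW (divr_gt0 E0 (mulr_gt0 sdv sdu))) M_bound.
rewrite /walk_sum_bound /stationary mulrBr -subr_ge0 -[_ <= m%:R]subr_ge0.
move/le_trans; apply; rewrite le_eqVlt; apply/orP; left; apply/eqP.
by field; rewrite !gt_eqF.
Qed.

End DepthBound.

(** * Reduction of the extended real inequality to the real one *)

Theorem theorem4p4 (R : realType) (n d m : nat) (d_gt0 : (0 < d)%N)
    (e : rel 'I_n) (e_simple : simple_graph e) (e_conn : connected_graph e)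
    (e_nonbip : ~ bipartite e)
    (lam : seq R) (lam_spec : is_spectrum (normalized_laplacian e) lam)
    (omega w c1 c2 cH : R)
    (N : mpnn R n d) (N_bounds : mpnn_bounds N m omega w c1 c2 cH)
    (N_sym : message_matrix N = sym_adjacency e)
    (small : Num.max w (omega / w + c1 * degree_ratio e + c2) <= 1)
    (y : 'M[R]_(n, d) -> R) (y_diff : twice_differentiable y)
    (v u : 'I_n)
    (osq_fin :
       (osq (message_matrix N) m omega w c1 c2 cH v u < +oo)%E)
    (osq_mix :
       (osq (message_matrix N) m omega w c1 c2 cH v u * mix y v u <= 1)%E) :
  let gamma := degree_ratio e : R in
  let mu := 1 + 2 * cH * (1 + gamma) in
  let beta := \big[Num.max/0]_(1 <= l < n) `|1 - c2 * lam`_l| in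
  let r := graph_dist e v u in
  beta < 1 /\
  (commute_time e v u / (4 * c2)%:E
   + ((num_edges e)%:R / Num.sqrt ((deg e v)%:R * (deg e u)%:R))%:E
     * (mix y v u / (gamma * mu)%:E
        - (c2^-1 * ((gamma + beta ^ (r%:Z - 1)) / lam`_1
                    + 2 * (cH / mu)))%:E)
   <= (m%:R)%:E)%E.
Proof.
case: n e e_simple e_conn e_nonbip lam_spec N N_bounds N_sym small y y_diff v u
  osq_fin osq_mix => [|n'] {}e {}e_simple {}e_conn {}e_nonbip {}lam_spec {}N
  {}N_bounds {}N_sym {}small {}y _ {}v {}u; first by case: v.
rewrite N_sym => osq_fin osq_mix gamma mu beta r.
have [P [PPT LP]] := symmetric_diagonalization
  (tr_normalized_laplacian (R := R) e_simple) lam_spec.2.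
move: small; rewrite ge_max => /andP[w_le1 {}small].
have w0 := w_gt0 N_bounds; have c20 := c2_gt0 N_bounds.
(* For [m = 0] the proxy sum is empty and its inverse infinite. The first layer is then used to see
   that [omega], [c1] and [cH] are nonnegative. *)
have m0 : (0 < m)%N.
  rewrite lt0n; apply/eqP => m0; move: osq_fin.
  by rewrite m0 /osq /osq_sum big_geq// inver eqxx ltxx.
have layer1 : (1 <= 1 <= m)%N by rewrite m0.
have omega0 := le_trans (opnorm_ge0 _) (Omega_le N_bounds layer1).
have c10 := le_trans (opnorm_ge0 _) (psi_d1 N_bounds layer1 (0, 0)).
have cH0 := le_trans (opnorm_ge0 _) (psi_hess N_bounds layer1 (0, 0)).
have beta_lt1 := contraction_lt1 e_simple e_conn e_nonbip lam_spec PPT LP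
  omega0 w0 c10 c20 small.
split; first exact: beta_lt1.
have osq_gt0 : 0 < osq_sum (sym_adjacency e) m omega w c1 c2 cH v u.
  rewrite lt_neqAle (osq_sum_ge0 e_simple e_conn e_nonbip m omega0 w0 c10 c20
    cH0 small) andbT eq_sym.
  by apply: contraTneq osq_fin => o0; rewrite /osq o0 inver eqxx ltxx.
(* As [d] is positive, the supremum is over a nonempty set of nonnegative values rather than
   [-oo]. *)
have mix_ge0 : (0 <= mix y v u)%E.
  pose i0 := Ordinal d_gt0.
  apply: (@le_trans _ _ (`|'D_(delta_mx v i0) ('D_(delta_mx u i0) y) 0|)%:E).
    by rewrite lee_fin.
  by apply: ereal_sup_ubound; exists 0, i0, i0.
have mix_le : (mix y v u
    <= (osq_sum (sym_adjacency e) m omega w c1 c2 cH v u)%:E)%E.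
  move: osq_mix; rewrite /osq inver gt_eqF// muleC.
  by rewrite lee_pdivrMr// mul1e.
have mix_fin : mix y v u \is a fin_num.
  by rewrite ge0_fin_numE// (le_lt_trans mix_le)// ltry.
move: mix_le; rewrite -(fineK mix_fin); move: (fine _) => M.
rewrite lee_fin => M_le.
have := depth_bound e_simple e_conn e_nonbip lam_spec PPT LP omega0 w0 w_le1 c10
  c20 cH0 small M_le osq_gt0.
(* The commute time enters the lower bound on [m] with a positive coefficient, so an upper bound on
   it suffices. *)
have tau_le := commute_time_hitting
  e_simple e_conn e_nonbip lam_spec PPT LP v u.
rewrite -lee_fin; apply: le_trans.
have gamma1 := degree_ratio_ge1 (R := R) e_conn e_nonbip v.
have gm_neq0 : gamma * mu != 0.
  have mu_ge1 : 1 <= mu.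
    by rewrite lerDl !mulr_ge0// addr_ge0// (le_trans ler01 gamma1).
  by rewrite mulf_neq0// gt_eqF// (lt_le_trans ltr01).
rewrite !inver (negbTE gm_neq0) gt_eqF ?mulr_gt0//.
rewrite EFinD leeD//.
by rewrite EFinM lee_wpmul2r// lee_fin invr_ge0 mulr_ge0// ltW.
Qed.
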